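(* Let $d\in\mathbb N=\{1,2,\dots\}$. For every $h\in\mathbb N$ let $D_h=dh+2h+1$, and for every $h\in\mathbb N$, $\theta=(\theta_1,\dots,\theta_{D_h})\in\mathbb R^{D_h}$ let $\mathcal N_h^\theta\colon\mathbb R^d\to\mathbb R$ be given for all $x=(x_1,\dots,x_d)\in\mathbb R^d$ by $$\mathcal N_h^\theta(x)=\theta_{dh+2h+1}+\sum_{i=1}^h\theta_{dh+h+i}\max\Bigl\{\theta_{dh+i}+\sum_{j=1}^d\theta_{(i-1)d+j}x_j,\,0\Bigr\}.$$ Let $a\in\mathbb R$, $b\in(a,\infty)$, let $(\Omega,\mathcal F,\mathbb P)$ be a probability space, for all $m,n\in\mathbb N_0$ let $X_n^m\colon\Omega\to[a,b]^d$ and $Y_n^m\colon\Omega\to\mathbb R$ be random variables, and for every $h\in\mathbb N$ let $\mathcal L^h\colon\mathbb R^{D_h}\to\mathbb R$ (real-valued) satisfy $\mathcal L^h(\theta)=\mathbb E[|\mathcal N_h^\theta(X_0^0)-Y_0^0|^2]$ for all $\theta\in\mathbb R^{D_h}$. Let $f\colon\mathbb R^d\to\mathbb R$ and $p\colon\mathbb R^d\to\mathbb R$ be continuous, assume $\mathbb P$-a.s. that $\mathbb E[Y_0^0\mid X_0^0]=f(X_0^0)$, assume $p^{-1}(\mathbb R\setminus\{0\})=(a,b)^d$, and assume $\mathbb P(X_0^0\in A)=\int_A p(x)\,dx$ for all Borel sets $A\subseteq\mathbb R^d$. For every $h\in\mathbb N$, $n\in\mathbb N_0$ let $M_n^h\in\mathbb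 N$, $\gamma_n^h\in\mathbb R$, let $\mathfrak L_n^h\colon\mathbb R^{D_h}\times\Omega\to\mathbb R$ satisfy $$\mathfrak L_n^h(\theta)=\frac1{M_n^h}\sum_{m=1}^{M_n^h}|\mathcal N_h^\theta(X_n^m)-Y_n^m|^2\quad\text{for all }\theta\in\mathbb R^{D_h},$$ let $\mathfrak G_n^h=(\mathfrak G_n^{h,1},\dots,\mathfrak G_n^{h,D_h})\colon\mathbb R^{D_h}\times\Omega\to\mathbb R^{D_h}$ satisfy, for all $i\in\{1,\dots,h\}$, all $j\in\{(i-1)d+1,\dots,(i-1)d+d\}\cup\{hd+i\}$, all $\theta\in\mathbb R^{D_h}$, and all $\omega\in\Omega$ for which the function $$\mathbb R^{d+1}\ni(\psi_1,\dots,\psi_{d+1})\mapsto\mathfrak L_n^h(\theta_1,\dots,\theta_{(i-1)d},\psi_1,\dots,\psi_d,\theta_{id+1},\dots,\theta_{dh+i-1},\psi_{d+1},\theta_{dh+i+1},\dots,\theta_{D_h},\omega)\in\mathbb R$$ is differentiable at $(\theta_{(i-1)d+1},\dots,\theta_{id},\theta_{hd+i})$, that $\mathfrak G_n^{h,j}(\theta,\omega)=(\tfrac{\partial}{\partial\theta_j}\mathfrak L_n^h)(\theta,\omega)$, and let $\Theta_n^h=(\Theta_n^{h,1},\dots,\Theta_n^{h,D_h})\colon\Omega\to\mathbb R^{D_h}$ be a random variable. Assume for all $h\in\mathbb N$, $n\in\mathbb N_0$ that $\Theta_{n+1}^h=\Theta_n^h-\gamma_n^h\,\mathfrak G_n^h(\Theta_n^h)$.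 Assume for all $h\in\mathbb N$ that $\Theta_0^{h,i}$, $i\in\{1,\dots,hd+h\}$, are independent. Let $q\colon\mathbb R\to[0,\infty)$ be measurable, let $\eta\in(0,\infty)$ satisfy $q((-\eta,\eta))\subseteq(0,\infty)$, and let $\kappa\in\mathbb R$ satisfy for all $h\in\mathbb N$, $i\in\{1,\dots,hd+h\}$, $x\in\mathbb R$ that $$\mathbb P(h^\kappa\,\Theta_0^{h,i}<x)=\int_{-\infty}^x q(y)\,dy\qquad\text{and}\qquad \mathbb E[|f(X_0^0)-Y_0^0|^2]\notin\mathcal L^h(\mathbb R^{D_h}).$$ Then $$\liminf_{h\to\infty}\mathbb P\Bigl(\liminf_{n\to\infty}\mathcal L^h(\Theta_n^h)>\inf_{\theta\in\mathbb R^{D_h}}\mathcal L^h(\theta)\Bigr)=1.$$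
   Context: $\mathbb N_0=\mathbb N\cup\{0\}$. For a function $F\colon\mathbb R^D\times\Omega\to E$ and $\Theta\colon\Omega\to\mathbb R^D$, $F(\Theta)$ denotes $\omega\mapsto F(\Theta(\omega),\omega)$, and $F(\theta)$ denotes $\omega\mapsto F(\theta,\omega)$ for $\theta\in\mathbb R^D$. $\mathcal L^h(\mathbb R^{D_h})$ denotes the image (range) of $\mathcal L^h$. *)

(* Defs.v *)
From HB Require Import structures.
From mathcomp Require Import all_boot all_order all_algebra.
From mathcomp Require Import all_classical all_reals all_analysis.

Set Implicit Arguments.
Unset Strict Implicit.
Unset Printing Implicit Defensive.

Import Order.TTheory GRing.Theory Num.Theory.
Import numFieldNormedType.Exports.

Local Open Scope classical_set_scope.
Local Open Scope ring_scope.

Section borel_rV.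
Context {R : realType} {n : nat}.

Definition borel_rV : set (set 'rV[R]_n) := <<s [set U | open U] >>.

Let borel_rV0 : borel_rV set0. Proof. exact: sigma_algebra0. Qed.

Let borel_rVC (A : set 'rV[R]_n) : borel_rV A -> borel_rV (~` A).
Proof. exact: sigma_algebraC. Qed.

Let borel_rV_bigcup (A : (set 'rV[R]_n)^nat) :
  (forall i, borel_rV (A i)) -> borel_rV (\bigcup_i A i).
Proof. exact: sigma_algebra_bigcup. Qed.

HB.instance Definition _ := @isMeasurable.Build default_measure_display
  'rV[R]_n borel_rV borel_rV0 borel_rVC borel_rV_bigcup.

Lemma open_measurable_rV (U : set 'rV[R]_n) : open U -> measurable U.
Proof. exact: sub_sigma_algebra. Qed.

Lemma measurable_coord_rV (j : 'I_n) :
  measurable_fun setT (fun x : 'rV[R]_n => x ord0 j).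
Proof.
apply: (measurability _ (measurable_realfun.RGenOpens.measurableE R)) => _ [_ [a [b ->]] <-].
rewrite setTI; apply: open_measurable_rV.
apply: open_comp; last exact: interval_open.
by move=> x _; exact: coord_continuous.
Qed.

Lemma open_rV_bigcup (U : set 'rV[R]_n) : open U ->
  exists D : set ('rV[rat]_n * 'rV[rat]_n), U = \bigcup_(c in D)
    \bigcap_(j : 'I_n)
      [set x | x ord0 j \in `]ratr (c.1 ord0 j), ratr (c.2 ord0 j)[].
Proof.
move=> oU.
pose box (c : 'rV[rat]_n * 'rV[rat]_n) := \bigcap_(j : 'I_n)
  [set x : 'rV[R]_n | x ord0 j \in `]ratr (c.1 ord0 j), ratr (c.2 ord0 j)[].
exists [set c | box c `<=` U]; apply/seteqP; split => [x Ux|x [c cU cx]];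
  last exact: cU.
have /nbhs_ballP[e /= e0 eU] : nbhs x U by exact: open_nbhs_nbhs.
have lo j : {q : rat | ratr q \in `]x ord0 j - e, x ord0 j[}.
  by apply/cid/rat_in_itvoo; rewrite ltrBlDr ltrDl.
have hi j : {q : rat | ratr q \in `]x ord0 j, x ord0 j + e[}.
  by apply/cid/rat_in_itvoo; rewrite ltrDl.
exists (\row_j sval (lo j), \row_j sval (hi j)).
  move=> y /= yc; apply: eU; split => // i j; rewrite ord1.
  have := yc j I; rewrite /= !mxE !in_itv/= => /andP[ly yh].
  have := svalP (lo j); have := svalP (hi j).
  rewrite !in_itv/= => /andP[h1 h2] /andP[l1 l2].
  rewrite /ball/= /ball_/= ltr_distlC (lt_trans l1 ly)/=.
  exact: lt_trans yh h2.
move=> j _; rewrite /= !mxE in_itv/=.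
have := svalP (lo j); have := svalP (hi j).
by rewrite !in_itv/= => /andP[-> _] /andP[_ ->].
Qed.

Lemma measurable_fun_rVP d (T : measurableType d) (f : T -> 'rV[R]_n) :
  measurable_fun setT f <->
  forall j, measurable_fun setT (fun t => f t ord0 j).
Proof.
split=> [mf j|mf].
  exact: (measurableT_comp (measurable_coord_rV j) mf).
apply: (@measurability _ _ _ _ _ _ (@open 'rV[R]_n)) => // _ [U oU <-].
rewrite setTI; have [D ->] := open_rV_bigcup oU.
rewrite preimage_bigcup bigcup_mkcond.
apply: countable_bigcupT_measurable => [|c]; first exact: countableP.
case: ifP => // _.
rewrite preimage_bigcap.
apply: fin_bigcap_measurable => // j _.
have := mf j measurableT `]ratr (c.1 ord0 j), ratr (c.2 ord0 j)[%classic
  (measurable_itv _).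
by rewrite setTI.
Qed.

End borel_rV.

Definition rV_cons {R : realType} {n : nat} (z : R * 'rV[R]_n) : 'rV[R]_n.+1 :=
  \row_j oapp (fun k => z.2 ord0 k) z.1 (unlift ord0 j).

Lemma measurable_rV_cons (R : realType) (n : nat) :
  measurable_fun setT (@rV_cons R n).
Proof.
apply/measurable_fun_rVP => j; case: (unliftP ord0 j) => [k|] ->.
  rewrite [X in measurable_fun _ X](_ : _ =
    (fun y : 'rV[R]_n => y ord0 k) \o snd).
    by apply: measurableT_comp => //; exact: measurable_coord_rV.
  by apply/funext => z /=; rewrite mxE liftK.
rewrite [X in measurable_fun _ X](_ : _ = fst)//.
by apply/funext => z /=; rewrite mxE unlift_none.
Qed.

Section lebesgue_rV.
Context {R : realType}.
Local Open Scope ereal_scope.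

Section step.
Context {n : nat} (m : {sigma_finite_measure set 'rV[R]_n -> \bar R}).

Definition lebesgue_rV_step : set 'rV[R]_n.+1 -> \bar R :=
  pushforward (@lebesgue_measure R \x m) (@rV_cons R n).

HB.instance Definition _ := Measure.copy lebesgue_rV_step
  (measure_function_pushforward__canonical__measure_function_Measure
    (@lebesgue_measure R \x m) (@measurable_rV_cons R n)).

Let lebesgue_rV_step_sigma_finite : sigma_finite setT lebesgue_rV_step.
Proof.
have /sigma_finiteP[A [TA ndA Aoo]] := sigma_finiteT (@lebesgue_measure R).
have /sigma_finiteP[B [TB ndB Boo]] := sigma_finiteT m.
pose F i := A i `*` B i.
have TF : \bigcup_i F i = setT.
  apply/seteqP; split => // -[y v] _.
  have [i _ Aiy] : (\bigcup_i A i) y by rewrite -TA.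
  have [k _ Bkv] : (\bigcup_i B i) v by rewrite -TB.
  exists (maxn i k) => //; split.
    by move: Aiy; exact/subsetPset/ndA/leq_maxl.
  by move: Bkv; exact/subsetPset/ndB/leq_maxr.
have Foo i : measurable (F i) /\ (@lebesgue_measure R \x m) (F i) < +oo.
  have [? ?] := Aoo i; have [? ?] := Boo i.
  split; first exact: measurableX.
  by rewrite product_measure1E// lte_mul_pinfty// ge0_fin_numE.
pose u (x : 'rV[R]_n.+1) : R * 'rV[R]_n :=
  (x ord0 ord0, \row_j x ord0 (lift ord0 j)).
have mu : measurable_fun setT u.
  apply: measurable_fun_pair => /=; first exact: measurable_coord_rV.
  apply/measurable_fun_rVP => j.
  under eq_fun do rewrite mxE.
  exact: measurable_coord_rV.
have uK z : u (rV_cons z) = z.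
  case: z => a v; rewrite /u !mxE unlift_none/=; congr pair.
  by apply/rowP => j; rewrite !mxE liftK.
exists (fun i => u @^-1` F i); first by rewrite -preimage_bigcup TF preimage_setT.
move=> i; have [mFi Fioo] := Foo i; split.
  by rewrite -[X in measurable X]setTI; exact: mu.
rewrite /lebesgue_rV_step /pushforward -comp_preimage.
by rewrite (_ : u \o _ = id) ?preimage_id//; apply/funext.
Qed.

HB.instance Definition _ := @Measure_isSigmaFinite.Build _ _ _
  lebesgue_rV_step lebesgue_rV_step_sigma_finite.

End step.

(* The Lebesgue measure of R^n, as the n-fold product of the Lebesgue measure
   of R (and the Dirac mass at the only point of R^0). *)
Fixpoint lebesgue_rV (n : nat) : {sigma_finite_measure set 'rV[R]_n -> \bar R} :=
  match n with
  | 0 => \d_(0%R : 'rV[R]_0)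
  | k.+1 => lebesgue_rV_step (lebesgue_rV k)
  end.

Lemma lebesgue_rV_box (n : nat) (a b : 'I_n -> R) :
  (forall j, a j <= b j)%R ->
  lebesgue_rV n [set x : 'rV[R]_n | forall j, x ord0 j \in `]a j, b j[%R] =
  (\prod_(j < n) (b j - a j))%:E.
Proof.
elim: n a b => [|n IHn] a b ab /=.
  by rewrite big_ord0 diracE mem_set//= => -[].
rewrite /lebesgue_rV_step /pushforward.
have -> : @rV_cons R n @^-1`
    [set x : 'rV[R]_n.+1 | forall j, x ord0 j \in `]a j, b j[%R] =
  `]a ord0, b ord0[%classic `*`
  [set x : 'rV[R]_n |
    forall j, x ord0 j \in `]a (lift ord0 j), b (lift ord0 j)[%R].
  apply/seteqP; split => [[y v] /= H|[y v] /= [H0 H] j].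
    split; first by have := H ord0; rewrite mxE unlift_none.
    by move=> j; have := H (lift ord0 j); rewrite mxE liftK.
  by case: (unliftP ord0 j) => [k|] ->; rewrite mxE ?liftK ?unlift_none//=.
rewrite product_measure1E//=; last first.
  rewrite [X in measurable X](_ : _ = \bigcap_(j : 'I_n)
    [set x : 'rV[R]_n | x ord0 j \in `]a (lift ord0 j), b (lift ord0 j)[%R]);
    last first.
    by apply/seteqP; split => [x H j _|x H j]; exact: H.
  apply: fin_bigcap_measurable => // j _.
  by have := @measurable_coord_rV R n j measurableT _
    (measurable_itv `]a (lift ord0 j), b (lift ord0 j)[%R); rewrite setTI.
rewrite IHn// lebesgue_measure_itv/= lte_fin big_ord_recl EFinM.
have := ab ord0; rewrite le_eqVlt => /predU1P[->|->]; last by rewrite EFinB.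
by rewrite ltxx subrr.
Qed.

End lebesgue_rV.

Section conditional_expectation.
Context d d' (Omega : measurableType d) (T : measurableType d') (R : realType).

(* Z is a version of E[Y | X]; [preimage_set_system setT X measurable] is the
   sigma-algebra generated by X. *)
Definition is_cond_expectation (P : probability Omega R) (X : Omega -> T)
    (Y Z : Omega -> R) : Prop :=
  let sigmaX : set (set Omega) := preimage_set_system setT X measurable in
  [/\ P.-integrable setT (EFin \o Y),
      P.-integrable setT (EFin \o Z),
      forall B : set R, measurable B -> sigmaX (Z @^-1` B) &
      forall A, sigmaX A ->
        (\int[P]_(w in A) (Z w)%:E = \int[P]_(w in A) (Y w)%:E)%E].

End conditional_expectation.

Definition mutually_independent d (Omega : measurableType d) (R : realType)
    (P : probability Omega R) (I : finType) (Z : I -> Omega -> R) : Prop :=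
  forall (J : {set I}) (B : I -> set R),
    (forall i, i \in J -> measurable (B i)) ->
    (P (\bigcap_(i in [set` J]) (Z i @^-1` B i)) =
      \prod_(i in J) P (Z i @^-1` B i))%E.

(* All indices below are 0-based: theta_k of the 1-based convention is
   [param theta k.-1], so that hidden neuron i : 'I_h has input weights
   i * d, ..., i * d + d - 1, bias d * h + i and output weight
   d * h + h + i, and the output bias is the last parameter. *)
Definition nparams (d h : nat) : nat := (d * h + 2 * h).+1.

Section shallow_relu_network.
Context {R : realType} {d h : nat}.
Implicit Types (theta : 'rV[R]_(nparams d h)) (x : 'rV[R]_d).

(* [inord] is only meaningful for k < nparams d h. *)
Definition param theta (k : nat) : R := theta ord0 (inord k).

Definition network theta x : R :=
  param theta (d * h + 2 * h) +
  \sum_(i < h) param theta (d * h + h + i) *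
    Num.max (param theta (d * h + i) +
             \sum_(j < d) param theta (i * d + j) * x ord0 j) 0.

Definition neuron_index (i : 'I_h) (k : nat) : bool :=
  (i * d <= k < i * d + d)%N || (k == h * d + i)%N.

Definition neuron_params theta (i : 'I_h) : 'rV[R]_d.+1 :=
  \row_(k < d.+1)
    if (k < d)%N then param theta (i * d + k) else param theta (h * d + i).

Definition set_neuron theta (i : 'I_h) (psi : 'rV[R]_d.+1) :
    'rV[R]_(nparams d h) :=
  \row_k if (i * d <= k < i * d + d)%N then psi ord0 (inord (k - i * d))
         else if (k == h * d + i :> nat)%N then psi ord0 ord_max
         else theta ord0 k.

End shallow_relu_network.

(* Main.v *)
Require Import Defs.
From HB Require Import structures.
From mathcomp Require Import all_boot all_order all_algebra.
From mathcomp Require Import all_classical all_reals all_analysis.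
From mathcomp Require Import measurable_realfun ring lra zify.

Set Implicit Arguments.
Unset Strict Implicit.
Unset Printing Implicit Defensive.

Import Order.TTheory GRing.Theory Num.Theory.
Import numFieldNormedType.Exports.

Local Open Scope classical_set_scope.
Local Open Scope ring_scope.

(** A hidden neuron whose preactivation is negative on all of [[a,b]^d], with a
    margin, is dead: the empirical losses are locally constant in its inner
    parameters, so gradient steps never revive it.  A given neuron is dead at
    initialization with a probability [c > 0] that does not depend on [h]
    (scaling by [h^kappa] preserves deadness), so some neuron is dead with
    probability at least [1 - (1 - c)^h].

    It remains to see that, for each neuron [i0], the losses of the networks
    with [i0] dead stay away from the infimum.  If not, follow an ultrafilter
    of networks with [i0] dead whose losses tend to the infimum.  Since the slot
    [i0] is free, adding any multiple of a ReLU neuron cannot improve the loss in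
    the limit, so the residuals become orthogonal to every ReLU neuron, hence to
    half spaces, exponentials, polynomials in exponentials, and finally to
    indicators of small neighbourhoods of points.  So the networks converge
    weakly to [f].  The normalized neurons converge, so away from finitely many
    hyperplanes the networks eventually lie in a fixed finite-dimensional space
    of piecewise affine functions, which therefore contains [f].  As [f] is
    continuous it is an affine function plus [h - 1] ReLU neurons, and the slot
    [i0] can carry the affine part: [f] is a network, against the hypothesis. *)

(** * Affine functions and continuous piecewise affine functions *)

(** The obstacle is that near-minimizing parameters may diverge: nearly opposite neurons can have
    output weights tending to infinity while their sum converges, so the infimum need not be
    attained and parameter space offers no compactness. Two devices replace it. Each neuron is
    rescaled to unit inner parameters, whose limit fixes a hyperplane; away from that hyperplane the
    neuron is eventually exactly affine or exactly zero, so its possibly divergent coefficients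
    enter only linearly, and a finite-dimensional span is closed whatever its coefficients do. And
    since only weak convergence is known, the span argument runs over functionals, given by small
    bumps that stay off the hyperplanes, instead of points. The price is a limit that is a priori
    discontinuous, with an arbitrary affine jump across each hyperplane; continuity of [f] brings it
    back to ReLUs. The contradiction only asks that [f] be a network on the closed cube: that is
    where the inputs lie, so the loss of this network is the excluded value. *)

Lemma near_all (T : Type) (F : set_system T) (FF : Filter F) (I : eqType) (r : seq I)
    (Q : I -> T -> Prop) :
  (forall i, i \in r -> \forall t \near F, Q i t) ->
  \forall t \near F, forall i, i \in r -> Q i t.
Proof.
elim: r => [|i r IH] H; first by near=> t => i; rewrite in_nil.
near=> t => j; rewrite in_cons => /predU1P[->|].
  by near: t; apply: H; rewrite mem_head.
move: j; near: t; apply: IH => j jr; apply: H; by rewrite in_cons jr orbT.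
Unshelve. all: by end_near. Qed.

(* The span of finitely many functions is closed under pointwise limits; it is
   enough that, at each point separately, the approximants eventually agree with
   their linear combination. *)
Lemma span_pointwise_closed (R : realType) (I : eqType) (T : Type) (D : set T)
    (r : seq I) (Th : Type) (F : set_system Th) (FF : ProperFilter F)
    (g : I -> T -> R) (al : I -> Th -> R) (N : Th -> T -> R) (f : T -> R) :
  uniq r ->
  (forall t, D t -> N th t @[th --> F] --> f t) ->
  (forall t, D t -> \forall th \near F,
     N th t = \sum_(i <- r) al i th * g i t) ->
  exists c : I -> R, forall t, D t -> f t = \sum_(i <- r) c i * g i t.
Proof.
elim: r g N f => [|i0 r IH] g N f /=.
  move=> _ Nf Ng; exists (fun=> 0) => t Dt; rewrite big_nil.
  apply: (@cvg_unique _ (@norm_hausdorff R _) _ _ _ _ (Nf t Dt)).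
  apply: cvg_near_cst; near=> th; rewrite (near (Ng t Dt) th)//.
  by rewrite big_nil.
move=> /andP[i0r ur] Nf Ng.
have [g0|] := pselect (forall t, D t -> g i0 t = 0).
  have [|||c cE] := IH g N f => //.
    move=> t Dt; near=> th; rewrite (near (Ng t Dt) th)//.
    by rewrite big_cons g0// mulr0 add0r.
  by exists c => t Dt; rewrite big_cons g0// mulr0 add0r; exact: cE.
move=> /existsNP[t0 /not_implyP[Dt0 /eqP g0]].
pose k t := g i0 t / g i0 t0.
have [|||c cE] := IH (fun i t => g i t - g i t0 * k t)
  (fun th t => N th t - N th t0 * k t) (fun t => f t - f t0 * k t) => //.
- by move=> t Dt; apply: cvgB; [exact: Nf|apply: cvgMr_tmp; exact: Nf].
- move=> t Dt; near=> th.
  rewrite (near (Ng t Dt) th)// (near (Ng t0 Dt0) th)// !big_cons.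
  under [RHS]eq_bigr do rewrite mulrBr mulrA.
  by rewrite sumrB -mulr_suml /k; field.
exists (fun i => if i == i0 then (f t0 - \sum_(i <- r) c i * g i t0) / g i0 t0
  else c i) => t Dt.
rewrite big_cons eqxx.
rewrite [X in _ + X](_ : _ = \sum_(i <- r) c i * g i t); last first.
  apply: eq_big_seq => i ir /=; case: (eqVneq i i0) => [ii0|//].
  by rewrite -ii0 ir in i0r.
have := cE t Dt.
under eq_bigr do rewrite mulrBr mulrA.
rewrite sumrB -mulr_suml => /eqP; rewrite subr_eq => /eqP ->.
by rewrite /k; field.
Unshelve. all: by end_near. Qed.

Section affine.
Context {R : realType} {V : lmodType R}.
Implicit Types (u a : V -> R) (x y z v : V) (O C : set V).

(** Linearity of [u - u 0], in one equation. *)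
Definition affine u := forall t x y, u (t *: x + y) = t * (u x - u 0) + u y.

Lemma affine_line u z v t : affine u ->
  u (z + t *: v) = u z + t * (u v - u 0).
Proof. by move=> au; rewrite addrC au addrC. Qed.

Lemma affine_segment u z y t : affine u ->
  u (z + t *: (y - z)) = u z + t * (u y - u z).
Proof.
move=> au; rewrite affine_line//.
by rewrite (_ : y - z = -1 *: z + y) ?au; [ring|rewrite scaleN1r addrC].
Qed.

Lemma affine_cst (c : R) : affine (fun=> c).
Proof. by move=> t x y; rewrite subrr mulr0 add0r. Qed.

Lemma affineD u a : affine u -> affine a -> affine (fun x => u x + a x).
Proof. by move=> au aa t x y; rewrite au aa; ring. Qed.

Lemma affineZ c u : affine u -> affine (fun x => c * u x).
Proof. by move=> au t x y; rewrite au; ring. Qed.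

Lemma affine_sum (I : Type) (r : seq I) (P : pred I) (w : I -> V -> R) :
  (forall i, P i -> affine (w i)) -> affine (fun x => \sum_(i <- r | P i) w i x).
Proof.
move=> aw; elim: r => [|i r IH] t x y.
  by rewrite !big_nil subrr mulr0 addr0.
rewrite !big_cons; case: ifP => [Pi|_]; last exact: IH.
by rewrite aw// IH; ring.
Qed.

Lemma affine_line_cvg u z v : affine u -> u (z + t *: v) @[t --> (0:R)] --> u z.
Proof.
move=> au; under eq_fun do rewrite affine_line//.
have : u z + t * (u v - u 0) @[t --> (0:R)] --> u z + 0 * (u v - u 0).
  by apply: cvgD; [exact: cvg_cst | apply: cvgMr_tmp; exact: cvg_id].
by rewrite mul0r addr0.
Qed.

Lemma affine_near_sign u z v : affine u -> u z != 0 ->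
  \forall t \near (0:R),
    (u (z + t *: v) != 0) && ((0 < u (z + t *: v)) == (0 < u z)).
Proof.
move=> au; case: (ltgtP (u z) 0) => // uz _.
  near=> t; have ut : u (z + t *: v) < 0.
    by near: t; apply: (cvgr_lt (u z)) uz; exact: affine_line_cvg.
  by rewrite lt_eqF//= ltNge (ltW ut).
near=> t; have ut : 0 < u (z + t *: v).
  by near: t; apply: (cvgr_gt (u z)) uz; exact: affine_line_cvg.
by rewrite gt_eqF//= ut.
Unshelve. all: by end_near. Qed.

Lemma near_at_right (x : R) (Q : set R) :
  (\forall t \near x, Q t) -> \forall t \near x^'+, Q t.
Proof. by move=> Qx; apply: cvg_within. Qed.

Lemma segment_near_neq0 u z y : affine u -> u z != 0 \/ u y != 0 ->
  \forall t \near (0:R)^'+, u (z + t *: (y - z)) != 0.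
Proof.
move=> au; have [uz [//|uy]|uz _] := eqVneq (u z) 0.
  near=> t; rewrite affine_segment// uz add0r subr0.
  apply: mulf_neq0 => //; near: t; exact: nbhs_right_neq.
apply: near_at_right; near=> t.
by have /andP[] : (u (z + t *: (y - z)) != 0) &&
  ((0 < u (z + t *: (y - z))) == (0 < u z)) by near: t; exact: affine_near_sign.
Unshelve. all: by end_near. Qed.

Definition line_convex O :=
  forall x y t, O x -> O y -> 0 <= t <= 1 -> O (x + t *: (y - x)).

(** All perturbations below move along lines, so [V] can be a bare vector space and every limit is
    taken in one real parameter. *)
Definition line_open O := forall x v, O x -> \forall t \near (0:R), O (x + t *: v).

Lemma segment_near C z y : line_convex C -> C z -> C y ->
  \forall t \near (0:R)^'+, C (z + t *: (y - z)).
Proof.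
move=> cC Cz Cy; near=> t; apply: cC => //; apply/andP; split.
  by apply: ltW; near: t; exact: nbhs_right_gt.
by near: t; exact: nbhs_right_le.
Unshelve. all: by end_near. Qed.

(** On a segment, an affine function that is nonzero at one end is nonzero at all small positive
    [t]. So a short move from a point that works for [r] towards one that works for [i] works for
    both. [C] will also be the section of an open set by a hyperplane, convex but not open. *)
Lemma affine_generic (I : eqType) (r : seq I) (u : I -> V -> R) C :
  (exists x, C x) -> line_convex C -> (forall i, i \in r -> affine (u i)) ->
  (forall i, i \in r -> exists2 y, C y & u i y != 0) ->
  exists2 y, C y & forall i, i \in r -> u i y != 0.
Proof.
move=> [x Cx] cC; elim: r => [|i r IH] au uy; first by exists x.
have [j jr|j jr|y Cy yr] := IH; first by apply: au; rewrite in_cons jr orbT.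
  by apply: uy; rewrite in_cons jr orbT.
have [y' Cy' y'i] := uy i (mem_head _ _).
near (0:R)^'+ => t.
exists (y + t *: (y' - y)); first by near: t; exact: segment_near.
near: t; apply: near_all => j; rewrite in_cons => /predU1P[->|jr].
  by apply: segment_near_neq0; [apply: au; exact: mem_head|right].
by apply: segment_near_neq0; [apply: au; rewrite in_cons jr orbT|left; exact: yr].
Unshelve. all: by end_near. Qed.

(** Along a direction [nu] in which [u] has slope 1, [x = z + v + u x *: nu] with [v] parallel to
    the hyperplane [u = 0]. Short moves from [z] along [v] stay in [O] and in the hyperplane, so [a]
    has slope 0 along [v]; hence [a x] is [u x] times the slope of [a] along [nu]. *)
Lemma affine_proportional u a O z : line_open O -> affine u -> affine a ->
  O z -> u z = 0 -> (exists y, u y != 0) ->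
  (forall x, O x -> u x = 0 -> a x = 0) -> exists c, forall x, a x = c * u x.
Proof.
move=> oO au aa Oz uz [y uy] a0.
pose nu := (u y)^-1 *: (y - z).
have unu x t : u (x + t *: nu) = u x + t.
  rewrite /nu scalerA affine_line//.
  have -> : u (y - z) - u 0 = u y.
    by rewrite (_ : y - z = -1 *: z + y) ?au ?uz; [ring|rewrite scaleN1r addrC].
  by rewrite -mulrA mulVf// mulr1.
exists (a nu - a 0) => x.
have az : a z = 0 by exact: a0.
pose v := x - z - u x *: nu.
have xE : x = z + 1 *: v + u x *: nu.
  by rewrite scale1r /v addrA subrK addrC subrK.
have lv : u v - u 0 = 0.
  have /eqP := unu (z + 1 *: v) (u x).
  rewrite -xE -subr_eq subrr affine_line// uz mul1r add0r => /eqP <-.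
  by [].
have av : a v - a 0 = 0.
  near (0:R)^'+ => t.
  have : a (z + t *: v) = 0.
    apply: a0; last by rewrite affine_line// lv mulr0 uz addr0.
    by near: t; apply: near_at_right; exact: oO.
  rewrite affine_line// az add0r => /eqP; rewrite mulf_eq0 => /orP[|/eqP//].
  by move=> /eqP t0; exfalso; move: t0; apply/eqP; near: t; exact: nbhs_right_neq.
by rewrite [in LHS]xE 2?affine_line// av az mulr0 !add0r mulrC.
Unshelve. all: by end_near. Qed.

End affine.

Section pw.
Context {R : realType} {V : lmodType R}.
Implicit Types (O C : set V).

(** At a point of the hyperplane [u i = 0] off the other hyperplanes only the [i]-th term jumps, by
    [a i]. Continuity makes [a i] vanish there, so [a i] is a multiple of [u i] and its term a
    multiple of a ReLU. Such points exist once hyperplanes missing [O] are absorbed into the affine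
    part and proportional ones are merged. *)
Lemma continuous_piecewise_affine (I : eqType) (r : seq I) (O : set V)
    (u a : I -> V -> R) (A f : V -> R) :
  line_open O -> line_convex O -> (exists x, O x) -> uniq r ->
  (forall i, i \in r -> affine (u i)) ->
  (forall i, i \in r -> exists2 y, O y & u i y != 0) ->
  (forall i, i \in r -> affine (a i)) -> affine A ->
  (forall x v, O x -> f (x + t *: v) @[t --> (0:R)] --> f x) ->
  (forall x, O x -> (forall i, i \in r -> u i x != 0) ->
    f x = A x + \sum_(i <- r) (if 0 < u i x then a i x else 0)) ->
  exists A' c, affine A' /\ forall x, O x ->
    f x = A' x + \sum_(i <- r) c i * Num.max (u i x) 0.
Proof.
move=> oO cO O0; elim: r a A f => [|i r IH] a A f /=.
  move=> _ _ _ _ aA _ fE; exists A, (fun=> 0); split => // x Ox.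
  by rewrite fE ?big_nil//.
move=> /andP[ir ur] au' u0' aa' aA cf fE.
have aui : affine (u i) by apply: au'; exact: mem_head.
have [yi Oyi uyi] : exists2 y, O y & u i y != 0 by apply: u0'; exact: mem_head.
have aai : affine (a i) by apply: aa'; exact: mem_head.
have inr j : j \in r -> j \in i :: r by move=> jr; rewrite in_cons jr orbT.
have au j : j \in r -> affine (u j) by move=> /inr; exact: au'.
have u0 j : j \in r -> exists2 y, O y & u j y != 0 by move=> /inr; exact: u0'.
have aa j : j \in r -> affine (a j) by move=> /inr; exact: aa'.
have drop_i A' (c : I -> R) x : f x = A' x + \sum_(j <- r) c j * Num.max (u j x) 0 ->
    f x = A' x + \sum_(j <- i :: r) (if j == i then 0 else c j) * Num.max (u j x) 0.
  move=> ->; rewrite big_cons eqxx mul0r add0r; congr (_ + _).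
  apply: eq_big_seq => j jr; case: (eqVneq j i) => [ji|//].
  by rewrite -ji jr in ir.
have fE' x : O x -> u i x != 0 -> (forall j, j \in r -> u j x != 0) ->
    f x = A x + (if 0 < u i x then a i x else 0) +
      \sum_(j <- r) (if 0 < u j x then a j x else 0).
  move=> Ox ux0 uj0; rewrite fE// ?big_cons ?addrA// => j.
  by rewrite in_cons => /predU1P[->//|]; exact: uj0.
(* If the hyperplane [u i = 0] misses [O], convexity gives [u i] a constant sign there, and its term
   joins the affine part or disappears. *)
have [[z Oz uz]|nz] := pselect (exists2 z, O z & u i z = 0); last first.
  have ui0 x : O x -> u i x != 0.
    by move=> Ox; apply/eqP => uix; apply: nz; exists x.
  have sgn x y : O x -> O y -> 0 < u i x -> u i y < 0 -> False.
    move=> Ox Oy ux uy; apply: nz.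
    have d0 : 0 < u i x - u i y by lra.
    exists (x + (u i x / (u i x - u i y)) *: (y - x)).
      apply: cO => //; apply/andP; split; first by rewrite divr_ge0// ltW.
      by rewrite ler_pdivrMr// mul1r; lra.
    rewrite affine_segment//; field; lra.
  have [||A' [c [aA' fA']]] := IH a
      (if 0 < u i yi then fun x => A x + a i x else A) f ur au u0 aa _ cf.
  - by case: ifP => // _; exact: affineD.
  - move=> x Ox uj0; rewrite fE'//; last exact: ui0.
    congr (_ + _); case: ifPn => h1; case: ifPn => h2; rewrite ?addr0//; exfalso.
      apply: (sgn x yi) => //; move: h2; rewrite -leNgt le_eqVlt.
      by rewrite (negbTE uyi).
    apply: (sgn yi x) => //; move: h1; rewrite -leNgt le_eqVlt.
    by rewrite (negbTE (ui0 _ Ox)).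
  by exists A', (fun j => if j == i then 0 else c j); split => // x Ox; apply: drop_i; exact: fA'.
have [[j jr [lam [lam0 ujE]]]|nprop] := pselect (exists2 j, j \in r &
    exists lam : R, lam != 0 /\ forall x, u j x = lam * u i x).
  (* Merge [i] into [j]: the two indicators agree or are complementary. *)
  pose e : R := if 0 < lam then 1 else -1.
  have [|||A' [c [aA' fA']]] := IH
      (fun k => if k == j then fun x => a j x + e * a i x else a k)
      (if 0 < lam then A else fun x => A x + a i x) f ur au u0 _ _ cf.
  - move=> k kr; case: ifP => _; last exact: aa.
    by apply: affineD; [exact: aa|exact: affineZ].
  - by case: ifP => // _; exact: affineD.
  - move=> x Ox uj0.
    have ui0 : u i x != 0.
      by have := uj0 _ jr; rewrite ujE mulf_eq0 negb_or => /andP[].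
    rewrite fE'// (bigD1_seq j)//= [in RHS](bigD1_seq j)//= eqxx.
    under [in RHS]eq_bigr => k kj do rewrite (negbTE kj).
    rewrite !addrA; congr (_ + _); rewrite /e ujE.
    move: lam0 ui0; rewrite !neq_lt => /orP[lam0|lam0] /orP[ui0|ui0].
    + by rewrite [0 < lam]ltNge (ltW lam0)/= nmulr_rgt0// ui0 [0 < u i x]ltNge (ltW ui0)/=; ring.
    + by rewrite [0 < lam]ltNge (ltW lam0)/= nmulr_rgt0// ui0 [u i x < 0]ltNge (ltW ui0)/=; ring.
    + by rewrite lam0 pmulr_rgt0// [0 < u i x]ltNge (ltW ui0)/=; ring.
    + by rewrite lam0 pmulr_rgt0// ui0; ring.
  by exists A', (fun j => if j == i then 0 else c j); split => // x Ox; apply: drop_i; exact: fA'.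
(* [a i] must vanish on the hyperplane [u i = 0], being the jump of [f] there. *)
have gen j : j \in r -> exists2 y, O y /\ u i y = 0 & u j y != 0.
  move=> jr; apply: contrapT => nex; apply: nprop; exists j => //.
  have [||lam lamE] := @affine_proportional _ _ (u i) (u j) O z oO aui (au _ jr) Oz uz.
  - by exists yi.
  - move=> x Ox uix; apply/eqP/negPn/negP => ujx; apply: nex.
    by exists x.
  exists lam; split => //; apply/eqP => l0.
  by have [y Oy] := u0 _ jr; rewrite lamE l0 mul0r eqxx.
pose H := [set x | O x /\ u i x = 0].
have cH : line_convex H.
  move=> x y t [Ox ux] [Oy uy] t01; split; first exact: cO.
  by rewrite affine_segment// ux uy; ring.
(* A point of [O] on this hyperplane and off all the others, by genericity within the section
   [H]. *)
have [|y0 [Oy0 uy0] gy0] := affine_generic (C := H) _ cH au gen.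
  by exists z.
pose nu := (u i yi)^-1 *: (yi - z).
have unu x t : u i (x + t *: nu) = u i x + t.
  rewrite /nu scalerA affine_line//.
  have -> : u i (yi - z) - u i 0 = u i yi.
    by rewrite (_ : yi - z = -1 *: z + yi) ?aui ?uz; [ring|rewrite scaleN1r addrC].
  by rewrite -mulrA mulVf// mulr1.
(* The affine function obtained by freezing the signs of the remaining [u j] at [x0]; near an [x0]
   off their hyperplanes it agrees, along every line, with the sum over [r]. *)
pose W x0 x := A x + \sum_(j <- r) (if 0 < u j x0 then a j x else 0).
have aW x0 : affine (W x0).
  apply: affineD => //; rewrite [X in affine X](_ : _ = (fun x =>
    \sum_(j <- r | j \in r) (if 0 < u j x0 then a j x else 0))); last first.
    by apply/funext => x; exact: big_seq.
  by apply: affine_sum => j jr; case: (0 < u j x0); [exact: aa|exact: affine_cst].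
have near_W x0 v : (forall j, j \in r -> u j x0 != 0) ->
    \forall t \near (0:R), (forall j, j \in r -> u j (x0 + t *: v) != 0) /\
      A (x0 + t *: v) + \sum_(j <- r) (if 0 < u j (x0 + t *: v) then
        a j (x0 + t *: v) else 0) = W x0 (x0 + t *: v).
  move=> uj0; near=> t.
  have ut : forall j, j \in r -> (u j (x0 + t *: v) != 0) &&
      ((0 < u j (x0 + t *: v)) == (0 < u j x0)).
    near: t; apply: near_all => j jr; apply: affine_near_sign; first exact: au.
    exact: uj0.
  split; first by move=> j /ut /andP[].
  congr (_ + _); apply: eq_big_seq => j jr.
  by have /andP[_ /eqP ->] := ut _ jr.
(* Approaching [x] from the two sides of the hyperplane, along [nu] and [- nu], gives limits of [f]
   that differ by [a i x]. *)
have jump x : O x -> u i x = 0 -> (forall j, j \in r -> u j x != 0) -> a i x = 0.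
  move=> Ox ux uj0.
  have lim1 : f x = W x x + a i x.
    have c1 : f (x + t *: nu) @[t --> (0:R)^'+] --> f x.
      by apply: cvg_at_right_filter; exact: cf.
    have c2 : f (x + t *: nu) @[t --> (0:R)^'+] --> W x x + a i x.
      apply: (@cvg_trans _ (W x (x + t *: nu) + a i (x + t *: nu) @[t --> (0:R)^'+])); last first.
        by apply: cvg_at_right_filter; apply: cvgD; exact: affine_line_cvg.
      apply: near_eq_cvg; near=> t.
      have t0 : 0 < t by near: t; exact: nbhs_right_gt.
      have [ut Wt] : (forall j, j \in r -> u j (x + t *: nu) != 0) /\
        A (x + t *: nu) + \sum_(j <- r) (if 0 < u j (x + t *: nu) then
        a j (x + t *: nu) else 0) = W x (x + t *: nu).
        by near: t; apply: near_at_right; exact: near_W.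
      rewrite fE' ?unu ?ux ?add0r ?t0 ?gt_eqF// -?Wt; first by ring.
      by near: t; apply: near_at_right; exact: oO.
    exact: (cvg_unique (@norm_hausdorff R _) c1 c2).
  have lim2 : f x = W x x.
    have c1 : f (x + t *: (- nu)) @[t --> (0:R)^'+] --> f x.
      by apply: cvg_at_right_filter; exact: cf.
    have c2 : f (x + t *: (- nu)) @[t --> (0:R)^'+] --> W x x.
      apply: (@cvg_trans _ (W x (x + t *: (- nu)) @[t --> (0:R)^'+])); last first.
        by apply: cvg_at_right_filter; exact: affine_line_cvg.
      apply: near_eq_cvg; near=> t.
      have t0 : 0 < t by near: t; exact: nbhs_right_gt.
      have [ut Wt] : (forall j, j \in r -> u j (x + t *: (- nu)) != 0) /\
        A (x + t *: (- nu)) + \sum_(j <- r) (if 0 < u j (x + t *: (- nu)) then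
        a j (x + t *: (- nu)) else 0) = W x (x + t *: (- nu)).
        by near: t; apply: near_at_right; exact: near_W.
      have ui : u i (x + t *: (- nu)) = - t by rewrite scalerN -scaleNr unu ux add0r.
      rewrite fE' ?ui ?oppr_eq0 ?oppr_gt0 ?gt_eqF// -?Wt.
        by rewrite ltNge (ltW t0)/=; ring.
      by near: t; apply: near_at_right; exact: oO.
    exact: (cvg_unique (@norm_hausdorff R _) c1 c2).
  by move: lim1; rewrite lim2; lra.
have jump_all x : O x -> u i x = 0 -> a i x = 0.
  move=> Ox ux.
  (* Points of the segment towards the generic point [y0] are generic for small [t]; as
     [a i y0 = 0], the equation becomes [(1 - t) * a i x = 0]. *)
  have genx : \forall t \near (0:R)^'+, a i x + t * (a i y0 - a i x) = 0.
    near=> t; rewrite -affine_segment//; apply: jump.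
    - by near: t; exact: segment_near.
    - by rewrite affine_segment// ux uy0; ring.
    - near: t; apply: near_all => j jr; apply: segment_near_neq0.
        exact: au.
      by right; exact: gy0.
  have ay0 : a i y0 = 0 by apply: jump.
  near (0:R)^'+ => t.
  have : a i x + t * (a i y0 - a i x) = 0 by near: t.
  rewrite ay0 sub0r => /eqP; rewrite -[X in X + _]mul1r mulrN -mulrBl mulf_eq0.
  move=> /orP[|/eqP//]; rewrite subr_eq0 => /eqP t1; exfalso.
  have : t < 1 by near: t; exact: nbhs_right_lt.
  by rewrite -t1 ltxx.
have [|c aE] := @affine_proportional _ _ (u i) (a i) O z oO aui aai Oz uz _ jump_all.
  by exists yi.
pose f' x := f x - c * Num.max (u i x) 0.
have cf' x v : O x -> f' (x + t *: v) @[t --> (0:R)] --> f' x.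
  move=> Ox.
  have hm : Num.max y 0 @[y --> u i x] --> Num.max (u i x) 0.
    apply: (@continuous_max _ _ (fun y : R => y) (fun=> 0) (u i x)).
      exact: cvg_id.
    exact: cvg_cst.
  have hu : u i (x + t *: v) @[t --> (0:R)] --> u i x by exact: affine_line_cvg.
  have hmu : Num.max (u i (x + t *: v)) 0 @[t --> (0:R)] --> Num.max (u i x) 0.
    exact: (cvg_comp _ _ hu hm).
  exact: cvgB (cf _ _ Ox) (cvgMl_tmp hmu).
have f'E0 x : O x -> u i x != 0 -> (forall j, j \in r -> u j x != 0) ->
    f' x = A x + \sum_(j <- r) (if 0 < u j x then a j x else 0).
  move=> Ox ui0 uj0; rewrite /f' fE'// aE.
  move: ui0; rewrite neq_lt => /orP[ui0|ui0].
    by rewrite [0 < u i x]ltNge (ltW ui0)/= max_r ?(ltW ui0)//; ring.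
  by rewrite ui0 max_l ?(ltW ui0)//; ring.
(* Points with [u i x = 0] are reached by continuity along the segment to [yi], on which [u i] is
   nonzero for small positive [t]. *)
have f'E x : O x -> (forall j, j \in r -> u j x != 0) ->
    f' x = A x + \sum_(j <- r) (if 0 < u j x then a j x else 0).
  move=> Ox uj0; have c1 : f' (x + t *: (yi - x)) @[t --> (0:R)^'+] --> f' x.
    by apply: cvg_at_right_filter; exact: cf'.
  have c2 : f' (x + t *: (yi - x)) @[t --> (0:R)^'+] --> W x x.
    apply: (@cvg_trans _ (W x (x + t *: (yi - x)) @[t --> (0:R)^'+])); last first.
      by apply: cvg_at_right_filter; exact: affine_line_cvg.
    apply: near_eq_cvg; near=> t.
    have [ut Wt] : (forall j, j \in r -> u j (x + t *: (yi - x)) != 0) /\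
      A (x + t *: (yi - x)) + \sum_(j <- r) (if 0 < u j (x + t *: (yi - x)) then
      a j (x + t *: (yi - x)) else 0) = W x (x + t *: (yi - x)).
      by near: t; apply: near_at_right; exact: near_W.
    rewrite -Wt f'E0//; first by near: t; exact: segment_near.
    by near: t; apply: segment_near_neq0 => //; right.
  exact: (cvg_unique (@norm_hausdorff R _) c1 c2).
have [A' [c' [aA' fA']]] := IH a A f' ur au u0 aa aA cf' f'E.
exists A', (fun j => if j == i then c else c' j); split => // x Ox.
rewrite big_cons eqxx.
rewrite [X in _ + (_ + X)](_ : _ = \sum_(j <- r) c' j * Num.max (u j x) 0); last first.
  apply: eq_big_seq => j jr; case: (eqVneq j i) => [ji|//].
  by rewrite -ji jr in ir.
by rewrite addrCA -fA'// /f'; ring.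
Unshelve. all: by end_near. Qed.

End pw.

(** * Functions asymptotically orthogonal to the residuals *)

Section real_expectation.
Context d (T : measurableType d) (R : realType) (P : probability T R).
Implicit Types f g : T -> R.

Definition rintegrable f := P.-integrable setT (EFin \o f).
Definition mean f : R := \int[P]_w f w.

Lemma rintegrable_meas f : rintegrable f -> measurable_fun setT f.
Proof. by move=> /measurable_int/measurable_EFinP. Qed.

Lemma rintegrable_le f g : measurable_fun setT f -> rintegrable g ->
  (forall w, `|f w| <= g w) -> rintegrable f.
Proof.
move=> mf ig fg; apply: le_integrable ig => //; first exact/measurable_EFinP.
by move=> w _ /=; rewrite lee_fin (le_trans (fg w))// ler_norm.
Qed.

Lemma rintegrable_bounded f M : measurable_fun setT f -> (forall w, `|f w| <= M) ->
  rintegrable f.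
Proof.
move=> mf fM; apply: (@rintegrable_le _ (fun=> M)) => //.
exact: finite_measure_integrable_cst.
Qed.

Lemma rintegrableD f g : rintegrable f -> rintegrable g -> rintegrable (fun w => f w + g w).
Proof. by move=> fi gi; have := integrableD measurableT fi gi. Qed.

Lemma rintegrableZ c f : rintegrable f -> rintegrable (fun w => c * f w).
Proof. by move=> fi; have := integrableZl measurableT c fi. Qed.

Lemma meanD f g : rintegrable f -> rintegrable g -> mean (fun w => f w + g w) = mean f + mean g.
Proof. exact: RintegralD. Qed.

Lemma meanZ c f : rintegrable f -> mean (fun w => c * f w) = c * mean f.
Proof. exact: RintegralZl. Qed.

Lemma meanB f g : rintegrable f -> rintegrable g -> mean (fun w => f w - g w) = mean f - mean g.
Proof. exact: RintegralB. Qed.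

Lemma mean_cst c : mean (fun=> c) = c.
Proof.
rewrite /mean Rintegral_cst// -[RHS]mulr1; congr (_ * _).
by rewrite -[RHS]/(fine 1%E); congr fine; exact: probability_setT.
Qed.

Lemma mean_le f g : rintegrable f -> rintegrable g -> (forall w, f w <= g w) ->
  mean f <= mean g.
Proof. by move=> fi gi fg; apply: le_Rintegral. Qed.

Lemma mean_norm f : rintegrable f -> `|mean f| <= mean (fun w => `|f w|).
Proof. exact: le_normr_Rintegral. Qed.

Lemma rintegrable_sum (I : Type) (r : seq I) (h : I -> T -> R) :
  (forall i, rintegrable (h i)) -> rintegrable (fun w => \sum_(i <- r) h i w).
Proof.
move=> hi; elim: r => [|i r IH].
  by under eq_fun do rewrite big_nil; apply: (@rintegrable_bounded _ 0) => // w; rewrite normr0.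
by under eq_fun do rewrite big_cons; exact: rintegrableD.
Qed.

Lemma mean_sum (I : Type) (r : seq I) (h : I -> T -> R) :
  (forall i, rintegrable (h i)) ->
  mean (fun w => \sum_(i <- r) h i w) = \sum_(i <- r) mean (h i).
Proof.
move=> hi; elim: r => [|i r IH].
  by under eq_fun do rewrite big_nil; rewrite big_nil mean_cst.
by under eq_fun do rewrite big_cons; rewrite big_cons meanD// ?IH//; exact: rintegrable_sum.
Qed.

Lemma rintegrable_norm f : rintegrable f -> rintegrable (fun w => `|f w|).
Proof. exact: integrable_norm. Qed.

Lemma mean_dominated (f_ : nat -> T -> R) f g :
  (forall n, measurable_fun setT (f_ n)) ->
  (forall w, f_ ^~ w @ \oo --> f w) ->
  rintegrable g -> (forall n w, `|f_ n w| <= g w) ->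
  mean (f_ n) @[n --> \oo] --> mean f.
Proof.
move=> mf ff gi fg; rewrite /mean /Rintegral.
have fi : rintegrable f.
  apply: (@rintegrable_le _ g) => //; first exact: (@measurable_fun_cvg _ _ _ setT f_ f mf).
  move=> w.
  have /cvgrPdist_le cfw := ff w.
  apply/ler_addgt0Pr => e e0; have := cfw e e0 => -[N _ /(_ N (leqnn N)) H].
  by rewrite -[f w](subrK (f_ N w)) addrC (le_trans (ler_normD _ _))// lerD.
apply: fine_cvg; rewrite fineK; last by apply: integrable_fin_num.
apply: (@dominated_cvg _ _ _ _ _ measurableT _ (EFin \o f) (EFin \o g)) => //.
- by move=> n; exact/measurable_EFinP.
- by move=> w _; apply: cvg_EFin; [exact: nearW|exact: ff].
- by move=> n w _ /=; rewrite lee_fin.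
Qed.

(** The free scale [s] puts a small factor on a bounded second moment and a large one on a vanishing
    second moment. *)
Lemma young (x y s : R) : 0 < s -> `|x * y| <= s * x ^+ 2 + s^-1 * y ^+ 2.
Proof.
move=> s0; have s0' : s != 0 by rewrite gt_eqF.
have h (a b : R) : 0 <= a -> 0 <= b -> a * b <= s * a ^+ 2 + s^-1 * b ^+ 2.
  move=> a0 b0; rewrite -subr_ge0.
  have -> : s * a ^+ 2 + s^-1 * b ^+ 2 - a * b =
    s^-1 * ((s * a - b) ^+ 2 + s * a * b) by field.
  by rewrite mulr_ge0 ?invr_ge0 ?(ltW s0)// addr_ge0 ?sqr_ge0// !mulr_ge0// ltW.
by rewrite normrM -(real_normK (num_real x)) -(real_normK (num_real y)) h.
Qed.

Lemma rintegrableM f g : measurable_fun setT f -> measurable_fun setT g ->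
  rintegrable (fun w => f w ^+ 2) -> rintegrable (fun w => g w ^+ 2) ->
  rintegrable (fun w => f w * g w).
Proof.
move=> mf mg fi gi.
apply: (@rintegrable_le _ (fun w => 1 * f w ^+ 2 + 1 * g w ^+ 2)).
- exact: measurable_funM.
- by apply: rintegrableD; exact: rintegrableZ.
- by move=> w; have := @young (f w) (g w) 1 ltr01; rewrite invr1.
Qed.

Lemma rintegrable_sqr_bounded f M : measurable_fun setT f -> (forall w, `|f w| <= M) ->
  rintegrable (fun w => f w ^+ 2).
Proof.
move=> mf fM; apply: (@rintegrable_bounded _ (M ^+ 2)).
  by apply: measurable_funX.
move=> w; rewrite normrX; apply: lerXn2r => //.
by rewrite nnegrE (le_trans _ (fM w)).
Qed.

End real_expectation.

(** * Closure properties of asymptotic orthogonality *)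

Section weak_null.
Context d (T : measurableType d) (R : realType) (P : probability T R).
Context (Th : Type) (F : set_system Th) (FF : Filter F).
Context (rho : Th -> T -> R) (C : R).
Hypothesis mrho : forall th, measurable_fun setT (rho th).
Hypothesis rho2 : forall th, rintegrable P (fun w => rho th w ^+ 2).
Hypothesis rhoC : \forall th \near F, mean P (fun w => rho th w ^+ 2) <= C.

Definition weak_null (psi : T -> R) := [/\ measurable_fun setT psi,
  exists M, forall w, `|psi w| <= M &
  mean P (fun w => rho th w * psi w) @[th --> F] --> 0].

Lemma rintegrable_rhoM (psi : T -> R) : measurable_fun setT psi ->
  (exists M, forall w, `|psi w| <= M) ->
  forall th, rintegrable P (fun w => rho th w * psi w).
Proof.
move=> mpsi [M psiM] th; apply: rintegrableM => //.
exact: rintegrable_sqr_bounded psiM.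
Qed.

Lemma weak_nullD (psi1 psi2 : T -> R) : weak_null psi1 -> weak_null psi2 ->
  weak_null (fun w => psi1 w + psi2 w).
Proof.
move=> [m1 b1 l1] [m2 b2 l2]; split; first exact: measurable_funD.
  move: b1 b2 => [M1 b1] [M2 b2]; exists (M1 + M2) => w.
  by rewrite (le_trans (ler_normD _ _))// lerD.
have : mean P (fun w => rho th w * psi1 w) + mean P (fun w => rho th w * psi2 w)
    @[th --> F] --> 0 + 0 by exact: cvgD.
rewrite addr0; apply: cvg_trans; apply: near_eq_cvg; apply: nearW => th.
rewrite -meanD; [|exact: rintegrable_rhoM|exact: rintegrable_rhoM].
by congr mean; apply/funext => w; rewrite mulrDr.
Qed.

Lemma weak_nullZ c (psi : T -> R) : weak_null psi -> weak_null (fun w => c * psi w).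
Proof.
move=> [m1 b1 l1]; split; first by apply: measurable_funM.
  move: b1 => [M1 b1]; exists (`|c| * M1) => w.
  by rewrite normrM ler_wpM2l.
have : c * mean P (fun w => rho th w * psi w) @[th --> F] --> c * 0 by exact: cvgMl_tmp.
rewrite mulr0; apply: cvg_trans; apply: near_eq_cvg; apply: nearW => th.
rewrite -meanZ; last exact: rintegrable_rhoM.
by congr mean; apply/funext => w; rewrite mulrCA.
Qed.

Lemma weak_null0 : weak_null (fun=> 0).
Proof.
split => //; first by exists 0 => w; rewrite normr0.
by under eq_fun do under eq_fun do rewrite mulr0; rewrite mean_cst; exact: cvg_cst.
Qed.

Lemma weak_null_sum (I : Type) (r : seq I) (h : I -> T -> R) :
  (forall i, weak_null (h i)) -> weak_null (fun w => \sum_(i <- r) h i w).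
Proof.
move=> hi; elim: r => [|i r IH].
  by under eq_fun do rewrite big_nil; exact: weak_null0.
by under eq_fun do rewrite big_cons; exact: weak_nullD.
Qed.

(** By dominated convergence [psi_ n] tends to [psi] in L2, while the second moments of [rho th] are
    eventually at most [C]; so the error made by replacing [psi] with a fixed [psi_ N] is small
    uniformly in [th] along [F]. *)
Lemma weak_null_lim (psi_ : nat -> T -> R) (psi : T -> R) M :
  (forall n, weak_null (psi_ n)) -> (forall n w, `|psi_ n w| <= M) ->
  (forall w, psi_ ^~ w @ \oo --> psi w) -> weak_null psi.
Proof.
move=> wn bM lim.
have mn n : measurable_fun setT (psi_ n) by have [] := wn n.
have mpsi : measurable_fun setT psi.
  exact: (@measurable_fun_cvg _ _ _ setT psi_ psi mn).
have bpsi w : `|psi w| <= M.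
  apply/ler_addgt0Pr => e e0.
  have /cvgrPdist_le/(_ e e0)[N _ /(_ N (leqnn N)) H] := lim w.
  by rewrite -[psi w](subrK (psi_ N w)) addrC (le_trans (ler_normD _ _))// lerD.
split => //; first by exists M.
pose dl n w := psi_ n w - psi w.
have mdl n : measurable_fun setT (dl n) by exact: measurable_funB.
have bdl n w : `|dl n w| <= M + M.
  by rewrite (le_trans (ler_normB _ _))// lerD.
have sdl n : rintegrable P (fun w => dl n w ^+ 2).
  exact: rintegrable_sqr_bounded (bdl n).
have dl0 : mean P (fun w => dl n w ^+ 2) @[n --> \oo] --> 0.
  rewrite (_ : nbhs 0 = nbhs (mean P (fun=> 0))); last by rewrite mean_cst.
  apply: (@mean_dominated _ _ _ _ _ _ (fun=> (M + M) ^+ 2)).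
  - by move=> n; apply: measurable_funX.
  - move=> w.
    have : (psi_ n w - psi w) * (psi_ n w - psi w) @[n --> \oo] -->
        (psi w - psi w) * (psi w - psi w).
      by apply: cvgM; apply: cvgB => //; exact: cvg_cst.
    by rewrite subrr mulr0.
  - by apply: (@rintegrable_bounded _ _ _ _ _ ((M + M) ^+ 2)) => // w; rewrite ger0_norm// sqr_ge0.
  - move=> n w; rewrite normrX; apply: lerXn2r => //.
    by rewrite nnegrE (le_trans _ (bdl n w)).
apply/cvgr0Pnorm_le => e e0.
(* [C'] is positive, [s * C' = e / 3], and [N] is taken with the second moment of [dl N] at most
   [e * s / 3], so that each of the three contributions is at most [e / 3]. *)
pose C' := Num.max C 1.
have C'0 : 0 < C' by rewrite lt_max ltr01 orbT.
pose s := e / (3 * C').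
have s0 : 0 < s by rewrite divr_gt0// mulr_gt0.
have es : 0 < e * s / 3 by rewrite divr_gt0// mulr_gt0.
have /cvgr0_norm_le/(_ _ es)[N _ /(_ N (leqnn N)) HN] := dl0.
have [_ _ /cvgr0_norm_le/(_ (e / 3))] := wn N.
move=> /(_ ltac:(by rewrite divr_gt0)) HF.
near=> th.
have H1 : `|mean P (fun w => rho th w * psi_ N w)| <= e / 3 by near: th.
have H2 : mean P (fun w => rho th w ^+ 2) <= C by near: th.
have -> : mean P (fun w => rho th w * psi w) =
    mean P (fun w => rho th w * psi_ N w) - mean P (fun w => rho th w * dl N w).
  rewrite -meanB.
  - by congr mean; apply/funext => w; rewrite /dl; ring.
  - by apply: rintegrable_rhoM => //; exists M.
  - by apply: rintegrable_rhoM => //; exists (M + M).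
have sm : rintegrable P (fun w => rho th w * dl N w).
  by apply: rintegrable_rhoM => //; exists (M + M).
have H3 : `|mean P (fun w => rho th w * dl N w)| <= s * C' + s^-1 * (e * s / 3).
  apply: (le_trans (mean_norm sm)).
  apply: (@le_trans _ _ (mean P (fun w => s * rho th w ^+ 2 + s^-1 * dl N w ^+ 2))).
    apply: mean_le; first exact: rintegrable_norm.
    - by apply: rintegrableD; exact: rintegrableZ.
    - by move=> w; exact: young.
  rewrite meanD; [|exact: rintegrableZ|exact: rintegrableZ].
  rewrite !meanZ//; apply: lerD.
    by apply: ler_wpM2l; [exact: ltW|rewrite (le_trans H2)// le_max lexx].
  apply: ler_wpM2l; first by rewrite invr_ge0 ltW.
  by rewrite (le_trans (ler_norm _)).
rewrite (le_trans (ler_normB _ _))// (le_trans (lerD H1 H3))//.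
have -> : s * C' = e / 3 by rewrite /s; field; rewrite gt_eqF.
have -> : s^-1 * (e * s / 3) = e / 3 by field; rewrite gt_eqF.
by lra.
Unshelve. all: by end_near. Qed.

End weak_null.

(** * Explicit approximations of indicators and exponentials *)

Section approx.
Context {R : realType}.

(** Two ReLUs make a ramp rising from 0 at 0 to 1 at [n.+1%:R^-1]. The limit at [y = 0] is 0, as for
    an open half line. *)
Lemma ramp_cvg (y : R) :
  n.+1%:R * Num.max y 0 - n.+1%:R * Num.max (y - n.+1%:R^-1) 0 @[n --> \oo] -->
  ((0 < y)%R%:R : R).
Proof.
have [y0|y0] := ltP 0 y.
  apply: cvg_near_cst.
  have := near_infty_natSinv_lt (PosNum y0); apply: filterS => n /= yn.
  rewrite max_l ?subr_ge0 ?(ltW yn)//.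
  by rewrite -mulrBr opprB addrC subrK mulfV.
apply: cvg_near_cst; apply: nearW => n.
rewrite max_r ?mulr0 ?subrr//.
by rewrite subr_le0 (le_trans y0)// invr_ge0.
Qed.

Lemma ramp_bound (y : R) n :
  `|n.+1%:R * Num.max y 0 - n.+1%:R * Num.max (y - n.+1%:R^-1) 0| <= 1.
Proof.
have n0 : 0 < n.+1%:R :> R by rewrite ltr0n.
have nV : n.+1%:R * n.+1%:R^-1 = 1 :> R by rewrite mulfV// gt_eqF.
have nV0 : 0 < n.+1%:R^-1 :> R by rewrite invr_gt0.
rewrite -mulrBr.
have [y0|y0] := leP y 0.
  by rewrite max_r ?subrr ?mulr0 ?normr0// subr_le0 (le_trans y0)// ltW.
have [y1|y1] := leP (y - n.+1%:R^-1) 0.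
  rewrite subr0 ger0_norm; last by rewrite mulr_ge0// ltW.
  by rewrite -[leRHS]nV; apply: ler_wpM2l; [exact: ltW|by rewrite -subr_le0].
by rewrite opprB addrC subrK nV normr1.
Qed.

(* Upper staircase of the exponential on a grid of mesh [dl]. *)
Definition expR_steps (s0 dl : R) (m : nat) (y : R) : R :=
  expR s0 + \sum_(0 <= k < m)
    (expR (s0 + k.+1%:R * dl) - expR (s0 + k%:R * dl)) * (0 < y - (s0 + k%:R * dl))%R%:R.

(** The staircase takes the value of the exponential at the first grid point at or above [y], hence
    within [dl] of [y]. The case of [y] beyond the grid, where the staircase is saturated, feeds the
    induction. *)
Lemma expR_stepsP (s0 dl y : R) m : 0 <= dl -> s0 <= y ->
  (s0 + m%:R * dl < y -> expR_steps s0 dl m y = expR (s0 + m%:R * dl)) /\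
  (y <= s0 + m%:R * dl -> expR y <= expR_steps s0 dl m y <= expR (y + dl)).
Proof.
move=> dl0 sy; elim: m => [|m [IH1 IH2]].
  rewrite /expR_steps big_geq// mul0r !addr0; split => // ys.
  by rewrite !ler_expR ys/= (le_trans sy)// lerDl.
have sm : s0 + m%:R * dl <= s0 + m.+1%:R * dl.
  by rewrite lerD2l ler_wpM2r// ler_nat.
have E : expR_steps s0 dl m.+1 y = expR_steps s0 dl m y +
    (expR (s0 + m.+1%:R * dl) - expR (s0 + m%:R * dl)) * (0 < y - (s0 + m%:R * dl))%R%:R.
  by rewrite /expR_steps big_nat_recr//= addrA.
rewrite E subr_gt0; split=> [ym|ym].
  have ym' := le_lt_trans sm ym.
  by rewrite ym' IH1// mulr1 addrC subrK.
have [ym'|ym'] := ltP (s0 + m%:R * dl) y.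
  rewrite IH1// mulr1 addrC subrK !ler_expR ym/=.
  by rewrite -natr1 mulrDl mul1r addrA lerD2r ltW.
by rewrite mulr0 addr0; exact: IH2.
Qed.

Lemma expR_steps_cvg (B y : R) : 0 <= B -> `|y| <= B ->
  expR_steps (- B) (2 * B / n.+1%:R) n.+1 y @[n --> \oo] --> expR y.
Proof.
move=> B0; rewrite ler_norml => /andP[yB1 yB2].
apply: (@squeeze_cvgr _ _ _ _ (fun=> expR y) (fun n => expR (y + 2 * B / n.+1%:R))).
- near=> n; apply: (proj2 (expR_stepsP _ _ _)) => //.
    by rewrite divr_ge0// mulr_ge0.
  by rewrite [n.+1%:R * _]mulrC divfK ?pnatr_eq0//; lra.
- exact: cvg_cst.
- have h : y + 2 * B / n.+1%:R @[n --> \oo] --> y.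
    have : y + 2 * B * n.+1%:R^-1 @[n --> \oo] --> y + 2 * B * 0.
      by apply: cvgD; [exact: cvg_cst|apply: cvgMl_tmp; exact: cvg_harmonic].
    by rewrite mulr0 addr0.
  exact: (cvg_comp _ _ h (@continuous_expR R y)).
Unshelve. all: by end_near. Qed.

Lemma expR_steps_bound (B y : R) n : 0 <= B -> `|y| <= B ->
  `|expR_steps (- B) (2 * B / n.+1%:R) n.+1 y| <= expR (3 * B).
Proof.
move=> B0; rewrite ler_norml => /andP[yB1 yB2].
have /andP[h1 h2] : expR y <= expR_steps (- B) (2 * B / n.+1%:R) n.+1 y <=
    expR (y + 2 * B / n.+1%:R).
  apply: (proj2 (expR_stepsP _ _ _)) => //.
    by rewrite divr_ge0// mulr_ge0.
  by rewrite [n.+1%:R * _]mulrC divfK ?pnatr_eq0//; lra.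
rewrite ger0_norm; last by rewrite (le_trans _ h1)// expR_ge0.
rewrite (le_trans h2)// ler_expR.
have : 2 * B / n.+1%:R <= 2 * B.
  by rewrite ler_pdivrMr ?ltr0n// ler_peMr ?mulr_ge0// ler1n.
move=> h; rewrite (le_trans (lerD yB2 h))//; lra.
Qed.

Lemma series_exp_coeff_le (x : R) n : `|series (exp_coeff x) n| <= expR `|x|.
Proof.
apply: (@le_trans _ _ (series (exp_coeff `|x|) n)).
  rewrite -normed_series_exp_coeff /series/= (le_trans (ler_norm_sum _ _ _))//.
apply: nondecreasing_cvgn_le; last exact: is_cvg_series_exp_coeff.
apply/nondecreasing_seqP => k; rewrite /series/= big_nat_recr//= lerDl.
by rewrite /exp_coeff /= divr_ge0// exprn_ge0.
Qed.

(* [n v^(2n)] rather than [v^n], so that the limit at [v = 1] is [0]. *)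
Lemma expR_powers_cvg (v : R) : 0 <= v ->
  expR (- (n%:R * (v ^+ n * v ^+ n))) @[n --> \oo] --> ((v < 1)%R%:R : R).
Proof.
move=> v0; have [v1|v1] := ltP v 1.
  have h0 : n%:R * (v ^+ n * v ^+ n) @[n --> \oo] --> (0:R).
    have vn : (1 - v)^-1 * v ^+ n @[n --> \oo] --> (1 - v)^-1 * 0.
      by apply: cvgMl_tmp; apply: cvg_expr; rewrite ger0_norm.
    rewrite mulr0 in vn.
    apply: (@squeeze_cvgr _ _ _ _ (fun=> 0) (fun n => (1 - v)^-1 * v ^+ n)) vn => //.
      apply: nearW => n; rewrite !mulr_ge0 ?exprn_ge0//= mulrA.
      apply: ler_wpM2r; first exact: exprn_ge0.
      rewrite -[(1 - v)^-1]mul1r ler_pdivlMr ?subr_gt0//.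
      have : \sum_(i < n) v ^+ n <= \sum_(i < n) v ^+ i.
        apply: ler_sum => i _; apply: ler_wiXn2l; [exact: v0|exact: ltW|].
        by apply: ltnW.
      rewrite sumr_const card_ord -[v ^+ n *+ n]mulr_natl => h.
      apply: (@le_trans _ _ ((\sum_(i < n) v ^+ i) * (1 - v))).
        by apply: ler_wpM2r => //; rewrite subr_ge0 ltW.
      have := subrX1 v n; have := exprn_ge0 n v0; lra.
    exact: cvg_cst.
  have h1 : - (n%:R * (v ^+ n * v ^+ n)) @[n --> \oo] --> (- 0:R) by exact: cvgN.
  have := cvg_comp _ _ h1 (@continuous_expR R (- 0)).
  by rewrite oppr0 expR0.
apply: (@squeeze_cvgr _ _ _ _ (fun=> 0) (fun n => expR (1 *- n))).
- apply: nearW => n; rewrite expR_ge0/= ler_expR lerN2 -[leLHS]mulr1.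
  by apply: ler_wpM2l => //; rewrite mulr_ege1// exprn_ege1.
- exact: cvg_cst.
- exact: cvgn_expR.
Qed.

End approx.

Definition preactivation {R : realType} {d : nat} (w : 'rV[R]_d) (b : R)
    (x : 'rV[R]_d) : R :=
  b + \sum_(j < d) w ord0 j * x ord0 j.

Section weak_null_relu.
Context d (T : measurableType d) (R : realType) (P : probability T R).
Context (Th : Type) (F : set_system Th) (FF : Filter F).
Context (rho : Th -> T -> R) (C : R).
Hypothesis mrho : forall th, measurable_fun setT (rho th).
Hypothesis rho2 : forall th, rintegrable P (fun w => rho th w ^+ 2).
Hypothesis rhoC : \forall th \near F, mean P (fun w => rho th w ^+ 2) <= C.
Context (n : nat) (X : T -> 'rV[R]_n) (beta : R).
Hypothesis Xbeta : forall t j, `|X t ord0 j| <= beta.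

Local Notation preact w b t := (preactivation w b (X t)).

Hypothesis relu0 : forall w b, weak_null P F rho (fun t => Num.max (preact w b t) 0).



Lemma preactivation_bound w b t : `|preact w b t| <= `|b| + \sum_(j < n) `|w ord0 j| * beta.
Proof.
rewrite (le_trans (ler_normD _ _))// lerD2l (le_trans (ler_norm_sum _ _ _))//.
by apply: ler_sum => j _; rewrite normrM ler_wpM2l.
Qed.

Lemma weak_null_halfspace w b : weak_null P F rho (fun t => (0 < preact w b t)%R%:R).
Proof.
apply: (weak_null_lim FF mrho rho2 rhoC (M := 1)
  (psi_ := fun k t => k.+1%:R * Num.max (preact w b t) 0 +
    (- k.+1%:R) * Num.max (preact w (b - k.+1%:R^-1) t) 0)).
- by move=> k; apply: weak_nullD => //; exact: weak_nullZ.
- move=> k t; have -> : preact w (b - k.+1%:R^-1) t = preact w b t - k.+1%:R^-1.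
    by rewrite /preactivation addrAC.
  by rewrite mulNr; exact: ramp_bound.
- move=> t; under eq_fun => k.
    have -> : preact w (b - k.+1%:R^-1) t = preact w b t - k.+1%:R^-1.
      by rewrite /preactivation addrAC.
    rewrite mulNr; over.
  exact: ramp_cvg.
Qed.

Lemma weak_null_cst c : weak_null P F rho (fun=> c).
Proof.
have := weak_nullZ FF mrho rho2 c (relu0 0 1).
congr weak_null; apply/funext => t; rewrite /preactivation big1 ?addr0.
  by rewrite max_l ?mulr1.
by move=> j _; rewrite mxE mul0r.
Qed.

(** A function of a single preactivation is a limit of staircases, whose steps are half-space
    indicators with the same [w] and shifted biases. *)
Lemma weak_null_expR w b : weak_null P F rho (fun t => expR (preact w b t)).
Proof.
pose B := `|b| + \sum_(j < n) `|w ord0 j| * beta.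
(* On an empty [T] nothing forces [beta], hence [B], to be nonnegative. *)
have [t0|nT] := pselect (exists t : T, True); last first.
  have -> : (fun t => expR (preact w b t)) = fun=> 0.
    by apply/funext => t; exfalso; apply: nT; exists t.
  exact: weak_null0.
have B0 : 0 <= B by case: t0 => t _; rewrite (le_trans _ (preactivation_bound w b t)).
apply: (weak_null_lim FF mrho rho2 rhoC (M := expR (3 * B))
  (psi_ := fun k t => expR_steps (- B) (2 * B / k.+1%:R) k.+1 (preact w b t))).
- move=> k; apply: weak_nullD => //; first exact: weak_null_cst.
  apply: weak_null_sum => // i; apply: weak_nullZ => //.
  have := weak_null_halfspace w (b - (- B + i%:R * (2 * B / k.+1%:R))).
  by congr weak_null; apply/funext => t; rewrite /preactivation addrAC.
- by move=> k t; apply: expR_steps_bound => //; exact: preactivation_bound.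
- by move=> t; apply: expR_steps_cvg => //; exact: preactivation_bound.
Qed.

(** Products of exponentials of affine functions are again of this form, so their span is an
    algebra. This is the passage from functions of one direction to functions that localize in all
    coordinates at once. *)
Inductive expalg : (T -> R) -> Prop :=
| expalg_exp c w b : expalg (fun t => c * expR (preact w b t))
| expalg_add f g : expalg f -> expalg g -> expalg (fun t => f t + g t).

Lemma expalgM f g : expalg f -> expalg g -> expalg (fun t => f t * g t).
Proof.
move=> fa; elim: fa g => {f} [c w b g ga|f1 f2 _ IH1 _ IH2 g ga]; last first.
  rewrite [X in expalg X](_ : _ = fun t => f1 t * g t + f2 t * g t).
    by apply: expalg_add; [exact: IH1|exact: IH2].
  by apply/funext => t; rewrite mulrDl.
elim: ga => {g} [c' w' b'|g1 g2 _ IH1 _ IH2].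
  rewrite [X in expalg X](_ : _ = fun t => (c * c') * expR (preact (w + w') (b + b') t)).
    exact: expalg_exp.
  apply/funext => t; rewrite (_ : preact (w + w') (b + b') t = preact w b t + preact w' b' t).
    by rewrite expRD; ring.
  rewrite /preactivation; under eq_bigr do rewrite mxE mulrDl.
  by rewrite big_split/= addrACA.
rewrite [X in expalg X](_ : _ = fun t => c * expR (preact w b t) * g1 t +
    c * expR (preact w b t) * g2 t).
  exact: expalg_add.
by apply/funext => t; rewrite mulrDr.
Qed.

Lemma expalg_cst c : expalg (fun=> c).
Proof.
rewrite [X in expalg X](_ : _ = fun t => c * expR (preact 0 0 t)).
  exact: expalg_exp.
apply/funext => t; rewrite /preactivation big1 ?addr0 ?expR0 ?mulr1//.
by move=> j _; rewrite mxE mul0r.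
Qed.

Lemma expalgX f k : expalg f -> expalg (fun t => f t ^+ k).
Proof.
move=> fa; elim: k => [|k IH]; first exact: expalg_cst.
by under eq_fun do rewrite exprS; exact: expalgM.
Qed.

Lemma expalg_sum (I : Type) (r : seq I) (h : I -> T -> R) :
  (forall i, expalg (h i)) -> expalg (fun t => \sum_(i <- r) h i t).
Proof.
move=> hi; elim: r => [|i r IH].
  by under eq_fun do rewrite big_nil; exact: expalg_cst.
by under eq_fun do rewrite big_cons; exact: expalg_add.
Qed.

Lemma weak_null_expalg f : expalg f -> weak_null P F rho f.
Proof.
elim=> {f} [c w b|f g _ IH1 _ IH2]; last exact: weak_nullD.
by apply: weak_nullZ => //; exact: weak_null_expR.
Qed.

Lemma weak_null_expR_expalg f : expalg f -> weak_null P F rho (fun t => expR (f t)).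
Proof.
move=> fa; have [_ [M fM] _] := weak_null_expalg fa.
apply: (weak_null_lim FF mrho rho2 rhoC (M := expR M)
  (psi_ := fun k t => series (exp_coeff (f t)) k)).
- move=> k; apply: weak_null_expalg; rewrite /series/=; apply: expalg_sum => i.
  rewrite /exp_coeff/=; under eq_fun do rewrite mulrC.
  by apply: expalgM; [exact: expalg_cst|exact: expalgX].
- move=> k t; rewrite (le_trans (series_exp_coeff_le _ _))// ler_expR.
  exact: fM.
- by move=> t; exact: is_cvg_series_exp_coeff.
Qed.

(** Powers of [v] stay in the algebra, and exponentials of its members are already weakly null;
    nonnegativity of [v] keeps the approximants bounded by 1. *)
Lemma weak_null_sublevel v : expalg v -> (forall t, 0 <= v t) ->
  weak_null P F rho (fun t => (v t < 1)%R%:R).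
Proof.
move=> va v0.
apply: (weak_null_lim FF mrho rho2 rhoC (M := 1)
  (psi_ := fun k t => expR (- (k%:R * (v t ^+ k * v t ^+ k))))).
- move=> k; apply: weak_null_expR_expalg.
  under eq_fun do rewrite -mulNr.
  apply: expalgM; first exact: expalg_cst.
  by apply: expalgM; exact: expalgX.
- move=> k t; rewrite ger0_norm ?expR_ge0// -expR0 ler_expR oppr_le0.
  by rewrite !mulr_ge0// exprn_ge0.
- by move=> t; exact: expR_powers_cvg.
Qed.

(** A scaled squared distance to [z], measured after applying [expR] to each coordinate: this puts
    it in [expalg], and on rows bounded below its sublevel sets still shrink to [z] as [s] grows. *)
Definition expbump (z : 'rV[R]_n) (s : R) (x : 'rV[R]_n) : R :=
  s * \sum_(j < n) (expR (x ord0 j) - expR (z ord0 j)) ^+ 2.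

Lemma weak_null_bump z s : 0 <= s -> weak_null P F rho (fun t => (expbump z s (X t) < 1)%R%:R).
Proof.
move=> s0; apply: weak_null_sublevel; last first.
  by move=> t; rewrite mulr_ge0// sumr_ge0// => j _; rewrite sqr_ge0.
apply: expalgM; first exact: expalg_cst.
apply: expalg_sum => j; apply: expalgX; apply: expalg_add; last exact: expalg_cst.
rewrite [X in expalg X](_ : _ = fun t => 1 * expR (preact (delta_mx ord0 j) 0 t)).
  exact: expalg_exp.
apply/funext => t; rewrite mul1r /preactivation add0r (bigD1 j)//= big1 ?addr0.
  by rewrite mxE !eqxx mul1r.
by move=> i /negbTE ij; rewrite mxE eqxx/= ij mul0r.
Qed.

End weak_null_relu.

(** * Networks and their losses *)

Section network_parameters.
Context {R : realType} {d h : nat}.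
Implicit Types (theta : 'rV[R]_(nparams d h)) (x : 'rV[R]_d) (i : 'I_h).

Definition weights theta i : 'rV[R]_d := \row_j param theta (i * d + j).
Definition bias theta i : R := param theta (d * h + i).
Definition outw theta i : R := param theta (d * h + h + i).
Definition outb theta : R := param theta (d * h + 2 * h).

Lemma networkE theta x : network theta x = outb theta +
  \sum_(i < h) outw theta i *
    Num.max (preactivation (weights theta i) (bias theta i) x) 0.
Proof.
rewrite /network; congr (_ + _); apply: eq_bigr => i _.
congr (_ * Num.max _ _); congr (_ + _).
by apply: eq_bigr => j _; rewrite mxE.
Qed.

Lemma param_row (g : nat -> R) k : (k < nparams d h)%N ->
  param (\row_(j < nparams d h) g j) k = g k.
Proof. by move=> kn; rewrite /param mxE inordK. Qed.

(** The four kinds of parameters occupy disjoint slots of the flat vector. This is how single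
    neurons are edited below. *)
Lemma network_params_surj (W : 'I_h -> 'rV[R]_d) (B C : 'I_h -> R) c :
  exists theta, [/\ weights theta = W, bias theta = B, outw theta = C &
    outb theta = c].
Proof.
pose on (g : 'I_h -> R) (k : nat) := oapp g 0 (insub k).
have onE g i : on g i = g i by rewrite /on insubT//= => lt; congr g; exact: val_inj.
pose g k := if (k < d * h)%N then
    on (fun i => oapp (fun j => W i ord0 j) 0 (insub (k %% d)%N)) (k %/ d)%N
  else if (k < d * h + h)%N then on B (k - d * h)%N
  else if (k < d * h + 2 * h)%N then on C (k - (d * h + h))%N else c.
exists (\row_(k < nparams d h) g k).
have ltw i (j : 'I_d) : (i * d + j < d * h)%N.
  by have := ltn_ord i; have := ltn_ord j; nia.
split.
- apply/funext => i; apply/rowP => j; rewrite mxE param_row; last first.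
    by rewrite /nparams; have := ltw i j; lia.
  rewrite /g ltw; have d0 : (0 < d)%N by have := ltn_ord j; lia.
  rewrite divnMDl// divn_small ?ltn_ord// addn0 onE modnMDl modn_small ?ltn_ord//.
  by rewrite insubT//= => lt; congr (W i ord0 _); exact: val_inj.
- apply/funext => i; rewrite /bias param_row; last first.
    by rewrite /nparams; have := ltn_ord i; lia.
  by rewrite /g ltnNge leq_addr/= ltn_add2l ltn_ord addKn onE.
- apply/funext => i; rewrite /outw param_row; last first.
    by rewrite /nparams; have := ltn_ord i; lia.
  rewrite /g ltnNge -addnA leq_addr/= ltn_add2l ltnNge leq_addr/=.
  by rewrite ltn_add2l mul2n -addnn ltn_add2l ltn_ord addnA addKn onE.
- rewrite /outb param_row; last by rewrite /nparams; lia.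
  by rewrite /g !ifN//; lia.
Qed.

(** For nonnegative [beta] the left-hand side is the largest preactivation on the box of radius
    [beta]. The strict inequality makes the condition open in the parameters, as the gradient
    argument requires. *)
Definition dead (beta : R) theta i : Prop :=
  bias theta i + \sum_(j < d) `|weights theta i ord0 j| * beta < 0.

Lemma dead_preactivation beta theta i x : dead beta theta i ->
  (forall j, `|x ord0 j| <= beta) ->
  Num.max (preactivation (weights theta i) (bias theta i) x) 0 = 0.
Proof.
move=> de xb; rewrite max_r// (le_trans _ (ltW de))// lerD2l.
apply: ler_sum => j _; apply: (le_trans (ler_norm _)).
by rewrite normrM ler_wpM2l.
Qed.

End network_parameters.

Section ultra.
Context {R : realType}.

(** Compactness gives a cluster point, which for an ultrafilter is a limit. One ultrafilter serves
    all neurons at once, where sequences would call for successive extractions. *)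
Lemma ultra_cvg_bounded (T : Type) (U : set_system T) (UU : UltraFilter U)
    (g : T -> R) (M : R) : (forall t, `|g t| <= M) -> exists l : R, g t @[t --> U] --> l.
Proof.
move=> gM.
have UF := @ultra_proper _ _ UU.
have cM := @segment_compact R (- M) M.
have [|l [_ cl]] := cM (g @ U) _.
  have : U (g @^-1` `[- M, M]) by apply: filterE => t /=; rewrite in_itv/= -ler_norml.
  by [].
exists l => A Al; have [//|UA] := @in_ultra_setVsetC _ _ (g @^-1` A) UU.
by have [y [/= nAy Ay]] := cl (~` A) A UA Al.
Qed.

End ultra.

Lemma cvg_sumr {R : realType} (T : Type) (F : set_system T) (FF : Filter F)
    (I : Type) (r : seq I) (g : I -> T -> R) (l : I -> R) :
  (forall i, g i t @[t --> F] --> l i) ->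
  \sum_(i <- r) g i t @[t --> F] --> \sum_(i <- r) l i.
Proof.
by move=> gl; apply: cvg_big => //; exact: add_continuous.
Qed.

Section row_topology.
Context {R : realType} {n : nat}.
Implicit Types (x y z : 'rV[R]_n).

Lemma ball_rowP x e y : 0 < e -> ball x e y <-> forall j, `|x ord0 j - y ord0 j| < e.
Proof.
move=> e0; split => [[_ xy] j|xy]; first exact: xy.
by split=> // i j; rewrite ord1; exact: xy.
Qed.

Lemma continuous_measurable_row (f : 'rV[R]_n -> R) : continuous f ->
  measurable_fun setT f.
Proof.
move=> cf.
apply: (measurability _ (measurable_realfun.RGenOpens.measurableE R)) => _ [_ [a [b ->]] <-].
rewrite setTI; apply: open_measurable_rV.
by apply: open_comp; [move=> x _; exact: cf|exact: interval_open].
Qed.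

Lemma continuous_line x v : continuous (fun t : R => x + t *: v).
Proof.
move=> t; have h : s *: v @[s --> t] --> t *: v by apply: cvgZr_tmp; exact: cvg_id.
exact: cvgD (cvg_cst x) h.
Qed.

Lemma continuous_expbump z s : continuous (expbump z s).
Proof.
move=> x.
have h j : (fun y : 'rV[R]_n => (expR (y ord0 j) - expR (z ord0 j)) ^+ 2) @ x -->
    (expR (x ord0 j) - expR (z ord0 j)) ^+ 2.
  have h0 : (fun y : 'rV[R]_n => expR (y ord0 j)) @ x --> expR (x ord0 j).
    exact: (cvg_comp _ _ (@coord_continuous R 1 n ord0 j x) (@continuous_expR R _)).
  have h1 : (fun y : 'rV[R]_n => expR (y ord0 j) - expR (z ord0 j)) @ x -->
      expR (x ord0 j) - expR (z ord0 j).
    exact: cvgB h0 (cvg_cst _).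
  by rewrite expr2; under eq_fun do rewrite expr2; exact: (cvgM h1 h1).
exact: cvgMl_tmp (cvg_sumr _ h).
Qed.

Lemma bump_center z s : expbump z s z = 0.
Proof. by rewrite /expbump big1 ?mulr0// => j _; rewrite subrr expr0n. Qed.

Lemma bump_near z s : exists2 e, 0 < e & forall y, ball z e y -> expbump z s y < 1.
Proof.
have : \forall y \near z, expbump z s y < 1.
  have h := @continuous_expbump z s z.
  by apply: (cvgr_lt _ h); rewrite bump_center.
by move=> /nbhs_ballP[e e0 H]; exists e.
Qed.

Lemma expR_dist (a u v : R) : a <= u -> a <= v -> expR a * `|u - v| <= `|expR u - expR v|.
Proof.
wlog uv : u v / u <= v => [hw|].
  have [|/ltW] := leP u v; first exact: hw.
  by move=> vu au av; rewrite distrC [leRHS]distrC; exact: hw.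
move=> au av; rewrite distrC ger0_norm ?subr_ge0// distrC ger0_norm ?subr_ge0 ?ler_expR//.
have -> : expR v = expR u * expR (v - u) by rewrite -expRD addrC subrK.
rewrite -[X in _ <= _ - X]mulr1 -mulrBr; apply: ler_pM; rewrite ?expR_ge0 ?subr_ge0 ?ler_expR//.
by have := expR_ge1Dx (v - u); lra.
Qed.

(** To the right of [a] the exponential expands distances by at least [expR a], so with
    [s = (expR a * r) ^- 2] a single coordinate at distance [r] from that of [z] already pushes the
    bump to 1. *)
Lemma bump_localize (a r : R) z : 0 < r -> (forall j, a <= z ord0 j) ->
  exists2 s, 0 <= s & forall y, (forall j, a <= y ord0 j) -> expbump z s y < 1 ->
    forall j, `|y ord0 j - z ord0 j| < r.
Proof.
move=> r0 az; have ar0 : 0 < expR a * r by rewrite mulr_gt0// expR_gt0.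
exists ((expR a * r) ^- 2) => [|y ay]; first by rewrite invr_ge0 sqr_ge0.
rewrite /expbump mulrC ltr_pdivrMr ?exprn_gt0// mul1r => H j.
have : (expR (y ord0 j) - expR (z ord0 j)) ^+ 2 < (expR a * r) ^+ 2.
  apply: le_lt_trans H; rewrite (bigD1 j)//= lerDl sumr_ge0// => i _.
  exact: sqr_ge0.
rewrite -(real_normK (num_real (_ - _))) ltr_pXn2r ?nnegrE ?(ltW ar0)//.
move=> /(le_lt_trans (expR_dist (ay j) (az j))).
by rewrite ltr_pM2l ?expR_gt0.
Qed.

End row_topology.

Section network_continuous.
Context {R : realType} {d h : nat}.
Implicit Types (theta : 'rV[R]_(nparams d h)) (x w : 'rV[R]_d).

Lemma continuous_preactivation w (b : R) : continuous (preactivation w b).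
Proof.
move=> x.
have hj j : (fun y : 'rV[R]_d => w ord0 j * y ord0 j) @ x --> w ord0 j * x ord0 j.
  exact: (cvgMl_tmp (@coord_continuous R 1 d ord0 j x)).
exact: (cvgD (cvg_cst b) (cvg_sumr _ hj)).
Qed.

Lemma continuous_relu w (b : R) :
  continuous (fun x => Num.max (preactivation w b x) 0).
Proof.
move=> x.
have hm : Num.max y 0 @[y --> preactivation w b x] --> Num.max (preactivation w b x) 0.
  apply: (@continuous_max _ _ (fun y : R => y) (fun=> 0) (preactivation w b x)).
    exact: cvg_id.
  exact: cvg_cst.
exact: (cvg_comp _ _ (@continuous_preactivation w b x) hm).
Qed.

Lemma continuous_network theta : continuous (network theta).
Proof.
rewrite (_ : network theta = fun x => outb theta + \sum_(i < h) outw theta i *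
    Num.max (preactivation (weights theta i) (bias theta i) x) 0); last first.
  by apply/funext => x; rewrite networkE.
move=> x.
have hi i : (fun y : 'rV[R]_d => outw theta i *
    Num.max (preactivation (weights theta i) (bias theta i) y) 0) @ x -->
    outw theta i * Num.max (preactivation (weights theta i) (bias theta i) x) 0.
  exact: (cvgMl_tmp (@continuous_relu (weights theta i) (bias theta i) x)).
exact: (cvgD (cvg_cst (outb theta)) (cvg_sumr _ hi)).
Qed.

Lemma network0 x : network (0 : 'rV[R]_(nparams d h)) x = 0.
Proof.
rewrite networkE /outb /param mxE add0r big1// => i _.
by rewrite /outw /param mxE mul0r.
Qed.

End network_continuous.

Section squared_loss.
Context {R : realType} {d h : nat} {disp} {Omega : measurableType disp}.
Context (P : probability Omega R) (X : Omega -> 'rV[R]_d) (Y : Omega -> R).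
Hypothesis mX : measurable_fun setT X.
Hypothesis mY : measurable_fun setT Y.
Context (L : 'rV[R]_(nparams d h) -> R).
Hypothesis LE : forall theta, (L theta)%:E =
  'E_P[(fun w => `|network theta (X w) - Y w| ^+ 2)%R]%E.

Definition residual (theta : 'rV[R]_(nparams d h)) w := Y w - network theta (X w).

Lemma measurable_residual theta : measurable_fun setT (residual theta).
Proof.
apply: measurable_funB => //.
apply: (measurableT_comp _ mX); apply: continuous_measurable_row.
exact: continuous_network.
Qed.

Lemma residual_sqr theta w :
  residual theta w ^+ 2 = `|network theta (X w) - Y w| ^+ 2.
Proof. by rewrite distrC real_normK ?num_real. Qed.

(** The loss is the real number [L theta], so the expectation in [LE] is finite. At [theta = 0] this
    makes [Y] itself square integrable. *)
Lemma rintegrable_residual_sqr theta : rintegrable P (fun w => residual theta w ^+ 2).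
Proof.
apply/integrableP; split.
  by apply/measurable_EFinP; apply: measurable_funX; exact: measurable_residual.
have := LE theta; rewrite unlock => E.
rewrite (_ : integral _ _ _ = (L theta)%:E) ?ltry// E.
apply: eq_integral => w _ /=; rewrite -residual_sqr.
by rewrite ger0_norm// sqr_ge0.
Qed.

Lemma mean_residual_sqr theta : mean P (fun w => residual theta w ^+ 2) = L theta.
Proof.
have := LE theta; rewrite unlock => E.
rewrite -[RHS]/(fine (L theta)%:E) E /mean /Rintegral; congr fine.
by apply: eq_integral => w _; rewrite residual_sqr.
Qed.

Lemma loss_ge0 theta : 0 <= L theta.
Proof. by rewrite -mean_residual_sqr; apply: Rintegral_ge0 => w _; exact: sqr_ge0. Qed.

Lemma rintegrable_Y_sqr : rintegrable P (fun w => Y w ^+ 2).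
Proof.
have := rintegrable_residual_sqr 0; congr rintegrable; apply/funext => w.
by rewrite /residual network0 subr0.
Qed.

End squared_loss.

(** * Near minimizers with a dead neuron *)

Section near_minimizers.
Context {R : realType} {d h : nat} (L : 'rV[R]_(nparams d h) -> R).
Context (D : set 'rV[R]_(nparams d h)).
Hypothesis L0 : forall theta, 0 <= L theta.
Hypothesis noGap : forall v theta', L theta' < v -> exists2 theta, D theta & L theta < v.

(** Competitors [theta'] range over all parameters, also outside [D], so that improvements obtained
    by reviving the dead neuron count; [noGap] is what keeps the filter proper. *)
Definition near_minimizers : set_system 'rV[R]_(nparams d h) :=
  [set A | exists2 e, 0 < e & forall theta, D theta ->
    (forall theta', L theta <= L theta' + e) -> A theta].

Lemma near_minimizers_proper : ProperFilter near_minimizers.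
Proof.
apply: Build_ProperFilter_ex.
  move=> A [e e0 eA].
  have hi : has_inf (range L).
    split; first by exists (L 0), 0.
    by exists 0 => _ [theta _ <-].
  have e20 : 0 < e / 2 by rewrite divr_gt0.
  have [_ [theta' _ <-] h1] := inf_adherent e20 hi.
  have [theta Dth h2] := noGap h1.
  have hlt : L theta' < inf (range L) + e / 2 := h1.
  exists theta; apply: eA => // theta''.
  have : inf (range L) <= L theta'' by apply: ge_inf; [case: hi|exists theta''].
  lra.
split.
- by exists 1.
- move=> A B [e1 e10 A1] [e2 e20 B2]; exists (Num.min e1 e2).
    by rewrite lt_min e10.
  move=> theta Dth H; split.
    apply: A1 => // theta'; rewrite (le_trans (H theta'))// lerD2l ge_min lexx//.
  by apply: B2 => // theta'; rewrite (le_trans (H theta'))// lerD2l ge_min lexx orbT.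
- by move=> A B AB [e e0 eA]; exists e => // theta Dth H; apply: AB; exact: eA.
Qed.

Lemma near_minimizersP e : 0 < e ->
  near_minimizers [set theta | D theta /\ forall theta', L theta <= L theta' + e].
Proof. by move=> e0; exists e. Qed.

End near_minimizers.

Section dead_neuron.
Context {R : realType} {d h : nat} (i0 : 'I_h) (beta : R).

Lemma dead_replace (theta : 'rV[R]_(nparams d h)) (w : 'rV[R]_d) (b s : R) : dead beta theta i0 ->
  exists theta' : 'rV[R]_(nparams d h), forall x : 'rV[R]_d, (forall j, `|x ord0 j| <= beta) ->
    network theta' x = network theta x + s * Num.max (preactivation w b x) 0.
Proof.
move=> de; have [theta' [W B C c]] := network_params_surj
  (fun i => if i == i0 then w else weights theta i)
  (fun i => if i == i0 then b else bias theta i)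
  (fun i => if i == i0 then s else outw theta i) (outb theta).
exists theta' => x xb; rewrite !networkE W B C c (bigD1 i0)//= eqxx.
rewrite [in RHS](bigD1 i0)//= (dead_preactivation de xb) mulr0 add0r.
rewrite addrCA addrC; congr (_ + _ + _); apply: eq_bigr => i /negbTE ->.
by [].
Qed.

Context {disp} {Omega : measurableType disp}.
Context (P : probability Omega R) (X : Omega -> 'rV[R]_d) (Y : Omega -> R).
Hypothesis mX : measurable_fun setT X.
Hypothesis mY : measurable_fun setT Y.
Hypothesis Xbeta : forall w j, `|X w ord0 j| <= beta.
Context (L : 'rV[R]_(nparams d h) -> R).
Hypothesis LE : forall theta, (L theta)%:E =
  'E_P[(fun w => `|network theta (X w) - Y w| ^+ 2)%R]%E.

(** First-order optimality: writing [r] times the ReLU into the dead slot changes the loss by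
    [r ^+ 2 * K - 2 * r * m], with [m] the mean to be bounded, and near minimality bounds this
    change from below for both signs of [r]. *)
Lemma near_minimizers_weak_null (U : set_system 'rV[R]_(nparams d h)) :
  Filter U -> near_minimizers L [set theta | dead beta theta i0] `<=` U ->
  forall w b, weak_null P U (residual X Y) (fun t => Num.max (preactivation w b (X t)) 0).
Proof.
move=> FU NU w b.
have mpsi : measurable_fun setT (fun t => Num.max (preactivation w b (X t)) 0).
  exact: (measurableT_comp (continuous_measurable_row (@continuous_relu _ _ w b)) mX).
have bpsi t : `|Num.max (preactivation w b (X t)) 0| <= `|b| + \sum_(j < d) `|w ord0 j| * beta.
  have := preactivation_bound Xbeta w b t; apply: le_trans.
  by have [|h0] := leP (preactivation w b (X t)) 0; rewrite ?normr0.
split => //; first by eexists; exact: bpsi.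
set psi := fun t => Num.max _ _ in mpsi bpsi *.
have ipsi2 : rintegrable P (fun t => psi t ^+ 2).
  exact: rintegrable_sqr_bounded bpsi.
pose K := mean P (fun t => psi t ^+ 2).
have K0 : 0 <= K by apply: Rintegral_ge0 => t _; exact: sqr_ge0.
apply/cvgr0Pnorm_le => e e0.
have K1 : 0 < K + 1 by rewrite ltr_wpDl.
(* With tolerance [s * e], taking [r] to be [s] or [- s] and dividing by [s] bounds twice the
   absolute mean by [s * K + e], where [s * K <= e]. *)
pose s := e / (K + 1).
have s0 : 0 < s by rewrite divr_gt0.
have es0 : 0 < s * e by rewrite mulr_gt0.
have := NU _ (near_minimizersP L [set theta | dead beta theta i0] es0).
apply: filterS => theta [de Lmin].
have ires := rintegrable_residual_sqr mX mY LE theta.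
have ipr : rintegrable P (fun t => residual X Y theta t * psi t).
  by apply: rintegrableM => //; exact: measurable_residual.
have key (r : R) : 2 * r * mean P (fun t => residual X Y theta t * psi t) <=
    r ^+ 2 * K + s * e.
  have [theta' th'] := dead_replace w b r de.
  have := Lmin theta'; rewrite -!(mean_residual_sqr LE).
  have -> : (fun t => residual X Y theta' t ^+ 2) = (fun t =>
      residual X Y theta t ^+ 2 + ((- (2 * r)) * (residual X Y theta t * psi t) +
      r ^+ 2 * psi t ^+ 2)).
    apply/funext => t; rewrite /residual th'; last by move=> j; exact: Xbeta.
    by rewrite /psi; ring.
  have i1 : rintegrable P (fun t => (- (2 * r)) * (residual X Y theta t * psi t)).
    exact: rintegrableZ.
  have i2 : rintegrable P (fun t => r ^+ 2 * psi t ^+ 2) by exact: rintegrableZ.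
  rewrite meanD//; last exact: rintegrableD.
  rewrite meanD// !meanZ// -/K; lra.
have sK : s * (K + 1) = e by rewrite /s; field; rewrite gt_eqF.
rewrite ler_norml; apply/andP; split.
  have := key (- s); rewrite sqrrN expr2 => h1.
  rewrite -(ler_pM2l s0); nra.
have := key s; rewrite expr2 => h1.
rewrite -(ler_pM2l s0); nra.
Qed.

End dead_neuron.

(** * Limits of neurons *)

Section limit_neurons.
Context {R : realType} {d h : nat}.
Implicit Types (theta : 'rV[R]_(nparams d h)) (x w : 'rV[R]_d) (i : 'I_h).

Definition aff_coord (k : 'I_d.+1) x : R :=
  oapp (fun j => x ord0 j) 1 (unlift ord0 k).

(** These products may diverge along the ultrafilter; they serve only as unconstrained coefficients
    of a finite span. *)
Definition neuron_coef theta i (k : 'I_d.+1) : R :=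
  outw theta i * oapp (fun j => weights theta i ord0 j) (bias theta i) (unlift ord0 k).

Lemma sum_aff_coord (g : 'I_d.+1 -> R) x :
  \sum_k g k * aff_coord k x = g ord0 + \sum_j g (lift ord0 j) * x ord0 j.
Proof.
rewrite big_ord_recl /aff_coord unlift_none/= mulr1; congr (_ + _).
by apply: eq_bigr => j _; rewrite liftK.
Qed.

Lemma neuron_coefE theta i x :
  \sum_k neuron_coef theta i k * aff_coord k x =
  outw theta i * preactivation (weights theta i) (bias theta i) x.
Proof.
rewrite sum_aff_coord /neuron_coef unlift_none/= /preactivation mulrDr; congr (_ + _).
by rewrite mulr_sumr; apply: eq_bigr => j _; rewrite liftK/= mulrA.
Qed.

Definition neuron_norm theta i : R :=
  `|bias theta i| + \sum_j `|weights theta i ord0 j|.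
(** A neuron with zero inner parameters is given the default bias 1 and weights 0, so that the
    normalized neuron always has norm 1. *)
Definition unit_bias theta i : R :=
  if neuron_norm theta i == 0 then 1 else bias theta i / neuron_norm theta i.
Definition unit_weights theta i : 'rV[R]_d :=
  if neuron_norm theta i == 0 then 0 else (neuron_norm theta i)^-1 *: weights theta i.

Lemma neuron_norm_ge0 theta i : 0 <= neuron_norm theta i.
Proof. by rewrite addr_ge0// sumr_ge0. Qed.

Lemma unit_neuron theta i : `|unit_bias theta i| + \sum_j `|unit_weights theta i ord0 j| = 1.
Proof.
rewrite /unit_bias /unit_weights; case: eqP => [_|/eqP n0].
  by rewrite normr1 big1 ?addr0// => j _; rewrite mxE normr0.
rewrite normrM normfV (ger0_norm (neuron_norm_ge0 _ _)).
under eq_bigr do rewrite mxE normrM normfV (ger0_norm (neuron_norm_ge0 _ _)) mulrC.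
by rewrite -mulr_suml -mulrDl mulfV.
Qed.

Lemma preactivation_unit theta i x :
  preactivation (weights theta i) (bias theta i) x =
  neuron_norm theta i * preactivation (unit_weights theta i) (unit_bias theta i) x.
Proof.
rewrite /unit_bias /unit_weights; case: eqP => [n0|/eqP n0].
  rewrite n0 mul0r; move/eqP: n0; rewrite paddr_eq0// ?sumr_ge0//.
  rewrite normr_eq0 => /andP[/eqP b0]; rewrite psumr_eq0// => /allP w0.
  rewrite /preactivation b0 add0r big1// => j _.
  by have := w0 j (mem_index_enum _); rewrite normr_eq0 => /eqP ->; rewrite mul0r.
rewrite /preactivation mulrDr mulrCA mulfV// mulr1; congr (_ + _).
rewrite mulr_sumr; apply: eq_bigr => j _; rewrite [X in _ * (X * _)]mxE.
by rewrite !mulrA mulfV// mul1r.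
Qed.

Lemma preactivation_dist w (b : R) w' (b' : R) x beta : (forall j, `|x ord0 j| <= beta) ->
  `|preactivation w b x - preactivation w' b' x| <=
    `|b - b'| + \sum_j `|w ord0 j - w' ord0 j| * beta.
Proof.
move=> xb; rewrite /preactivation opprD addrACA -sumrB.
rewrite (le_trans (ler_normD _ _))// lerD2l (le_trans (ler_norm_sum _ _ _))//.
by apply: ler_sum => j _; rewrite -mulrBl normrM ler_wpM2l.
Qed.

(** Normalized inner parameters converge along [U], to a limit of norm 1, and the normalized
    preactivations converge uniformly on the box. Where the limit is at least [e] in absolute value
    their signs eventually agree with its sign, so the ReLU is exactly the identity or exactly zero,
    whatever the size of the output weight. *)
Lemma ultra_neuron_limit (U : set_system 'rV[R]_(nparams d h)) (UU : UltraFilter U)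
    (beta : R) i :
  exists (w : 'rV[R]_d) (b : R), `|b| + \sum_j `|w ord0 j| = 1 /\
    forall e, 0 < e -> \forall theta \near U, forall x,
      (forall j, `|x ord0 j| <= beta) -> e <= `|preactivation w b x| ->
      outw theta i * Num.max (preactivation (weights theta i) (bias theta i) x) 0 =
      if 0 < preactivation w b x then \sum_k neuron_coef theta i k * aff_coord k x else 0.
Proof.
have UF := @ultra_proper _ _ UU.
have ub1 theta : `|unit_bias theta i| <= 1.
  by rewrite -(unit_neuron theta i) lerDl sumr_ge0.
have uw1 j theta : `|unit_weights theta i ord0 j| <= 1.
  rewrite -(unit_neuron theta i) (bigD1 j)//= addrCA lerDl addr_ge0// sumr_ge0//.
have [b hb] := ultra_cvg_bounded UU ub1.
have /choice[w hw] : forall j, exists l : R, unit_weights theta i ord0 j @[theta --> U] --> l.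
  by move=> j; exact: (ultra_cvg_bounded UU (uw1 j)).
exists (\row_j w j), b; split.
  have c1 : `|unit_bias theta i| + \sum_j `|unit_weights theta i ord0 j| @[theta --> U] -->
      `|b| + \sum_j `|w j|.
    apply: cvgD; first exact: cvg_norm.
    by apply: cvg_sumr => j; exact: cvg_norm.
  under eq_bigr do rewrite mxE.
  move: c1; under eq_fun do rewrite unit_neuron.
  move=> c1; have c2 : (fun=> 1 : R) @ U --> (1:R) by exact: cvg_cst.
  exact: (cvg_unique (@norm_hausdorff R _) c1 c2).
move=> e e0.
have c0 : `|unit_bias theta i - b| + \sum_j `|unit_weights theta i ord0 j - w j| * beta
    @[theta --> U] --> (0:R).
  have : `|unit_bias theta i - b| + \sum_j `|unit_weights theta i ord0 j - w j| * beta
    @[theta --> U] --> `|b - b| + \sum_j `|w j - w j| * beta.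
    apply: cvgD; first by apply: cvg_norm; apply: cvgB => //; exact: cvg_cst.
    apply: cvg_sumr => j; apply: cvgMr_tmp; apply: cvg_norm.
    by apply: cvgB => //; exact: cvg_cst.
  by rewrite subrr normr0 add0r big1// => j _; rewrite subrr normr0 mul0r.
near=> theta => x xb ex.
have H : `| `|unit_bias theta i - b| +
    \sum_j `|unit_weights theta i ord0 j - w j| * beta| < e.
  by near: theta; exact: cvgr0_norm_lt c0 _ e0.
rewrite neuron_coefE preactivation_unit.
set y := preactivation (unit_weights _ _) _ _.
set z := preactivation _ _ x in ex *.
have yz : `|y - z| < e.
  apply: (le_lt_trans (preactivation_dist _ _ _ _ xb)).
  apply: (le_lt_trans _ H); apply: (le_trans _ (ler_norm _)).
  by under [in leLHS]eq_bigr do rewrite mxE.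
have n0 := neuron_norm_ge0 theta i.
move: yz ex; rewrite ltr_norml => /andP[yz1 yz2].
have [z0|z0] := ltP 0 z => ez.
  by rewrite max_l// mulr_ge0//; rewrite ger0_norm ?(ltW z0)// in ez; lra.
rewrite max_r ?mulr0// mulr_ge0_le0//; rewrite ler0_norm// in ez; lra.
Unshelve. all: by end_near. Qed.

End limit_neurons.

Section cube.
Context {R : realType} {d : nat} (a b : R).
Hypothesis ab : a < b.
Implicit Types (x y v w : 'rV[R]_d).

Lemma affine_preactivation w (c : R) : affine (preactivation w c).
Proof.
move=> t x y; rewrite /preactivation.
rewrite [X in _ = t * (_ - (_ + X)) + _]big1; last by move=> j _; rewrite mxE mulr0.
under eq_bigr do rewrite !mxE mulrDr mulrCA.
rewrite big_split/= -mulr_sumr; ring.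
Qed.

Lemma affine_rowE (A : 'rV[R]_d -> R) x : affine A ->
  A x = preactivation (\row_j (A (delta_mx ord0 j) - A 0)) (A 0) x.
Proof.
move=> aA; rewrite /preactivation {1}[x]row_sum_delta.
under [in RHS]eq_bigr do rewrite mxE.
elim: (index_enum _) => [|j r IH]; first by rewrite !big_nil addr0.
by rewrite !big_cons aA IH; ring.
Qed.

Definition open_cube : set 'rV[R]_d := [set x | forall j, a < x ord0 j < b].
Definition closed_cube : set 'rV[R]_d := [set x | forall j, a <= x ord0 j <= b].

Lemma open_cube_nbhs x : open_cube x -> nbhs x open_cube.
Proof.
move=> Ox; rewrite (_ : open_cube = ball (const_mx ((a + b) / 2)) ((b - a) / 2)).
  apply: open_nbhs_nbhs; split; first exact: ball_open.
  apply/ball_rowP; first by rewrite divr_gt0// subr_gt0.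
  by move=> j; have /andP[h1 h2] := Ox j; rewrite mxE ltr_norml; apply/andP; split; lra.
apply/seteqP; split => y.
  move=> Oy; apply/ball_rowP; first by rewrite divr_gt0// subr_gt0.
  by move=> j; have /andP[h1 h2] := Oy j; rewrite mxE ltr_norml; apply/andP; split; lra.
move=> /ball_rowP H j; have := H _ j; rewrite divr_gt0 ?subr_gt0// => /(_ erefl).
by rewrite mxE ltr_norml => /andP[h1 h2]; apply/andP; split; lra.
Qed.

Lemma line_cvg (f : 'rV[R]_d -> R) x v : {for x, continuous f} ->
  f (x + t *: v) @[t --> (0:R)] --> f x.
Proof.
move=> cf; have h := @continuous_line R d x v 0.
rewrite /continuous_at scale0r addr0 in h.
exact: (cvg_comp _ _ h cf).
Qed.

Lemma line_open_cube : line_open open_cube.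
Proof.
move=> x v /open_cube_nbhs Ox; have h := @continuous_line R d x v 0.
by rewrite /continuous_at scale0r addr0 in h; exact: (h _ Ox).
Qed.

Lemma line_convex_cube : line_convex open_cube.
Proof.
move=> x y t Ox Oy /andP[t0 t1] j; rewrite !mxE.
have /andP[x1 x2] := Ox j; have /andP[y1 y2] := Oy j.
have E : x ord0 j + t * (y ord0 j - x ord0 j) = (1 - t) * x ord0 j + t * y ord0 j by ring.
have [->|tn0] := eqVneq t 0; first by rewrite mul0r addr0 x1.
have tp : 0 < t by rewrite lt_neqAle eq_sym tn0.
have t1' : 0 <= 1 - t by lra.
rewrite E; apply/andP; split.
  have := ler_wpM2l t1' (ltW x1); have : t * a < t * y ord0 j by rewrite ltr_pM2l.
  lra.
have := ler_wpM2l t1' (ltW x2); have : t * y ord0 j < t * b by rewrite ltr_pM2l.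
lra.
Qed.

Lemma open_cube_center : open_cube (const_mx ((a + b) / 2)).
Proof. by move=> j; rewrite mxE; apply/andP; split; have := ab; lra. Qed.

(** Points of the closed cube are limits of interior points along the segment to the center. Inputs
    may lie on the faces, while [f] is identified in the interior. *)
Lemma eq_closed_cube (f g : 'rV[R]_d -> R) : continuous f -> continuous g ->
  {in open_cube, f =1 g} -> {in closed_cube, f =1 g}.
Proof.
move=> cf cg fg x; rewrite inE => Cx.
pose c : 'rV[R]_d := const_mx ((a + b) / 2).
have c1 : f (x + t *: (c - x)) @[t --> (0:R)^'+] --> f x.
  by apply: cvg_at_right_filter; apply: line_cvg; exact: cf.
have c2 : g (x + t *: (c - x)) @[t --> (0:R)^'+] --> g x.
  by apply: cvg_at_right_filter; apply: line_cvg; exact: cg.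
apply: (cvg_unique (@norm_hausdorff R _) c1); apply: cvg_trans c2.
apply: near_eq_cvg; near=> t.
have t0 : 0 < t by near: t; exact: nbhs_right_gt.
have t1 : t < 1 by near: t; exact: nbhs_right_lt.
rewrite fg// inE => j; rewrite !mxE; have /andP[x1 x2] := Cx j.
have t1' : 0 <= 1 - t by lra.
have := ler_wpM2l t1' x1; have := ler_wpM2l t1' x2.
have : t * a < t * ((a + b) / 2) by rewrite ltr_pM2l//; have := ab; lra.
have : t * ((a + b) / 2) < t * b by rewrite ltr_pM2l//; have := ab; lra.
by move=> h1 h2 h3 h4; apply/andP; split; lra.
Unshelve. all: by end_near. Qed.

Lemma affine_neq0_cube w (c : R) : `|c| + \sum_j `|w ord0 j| = 1 ->
  exists2 x, open_cube x & preactivation w c x != 0.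
Proof.
move=> n1; apply: contrapT => nex.
pose z : 'rV[R]_d := const_mx ((a + b) / 2).
have z0 x : open_cube x -> preactivation w c x = 0.
  by move=> Ox; apply/eqP/negPn/negP => ne; apply: nex; exists x.
have aff := affine_preactivation w c.
have lin0 v : preactivation w c v = preactivation w c 0.
  near (0:R)^'+ => t.
  have := z0 (z + t *: v); rewrite affine_line// (z0 _ open_cube_center) add0r => H.
  have /H/eqP : open_cube (z + t *: v).
    near: t; apply: near_at_right; apply: line_open_cube; exact: open_cube_center.
  rewrite mulf_eq0 subr_eq0 => /orP[|/eqP//].
  move=> /eqP t0; exfalso; move: t0; apply/eqP; near: t; exact: nbhs_right_neq.
have c0 : c = 0.
  have := lin0 z; rewrite (z0 _ open_cube_center) /preactivation big1 ?addr0//.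
  by move=> j _; rewrite mxE mulr0.
have w0 j : w ord0 j = 0.
  have := lin0 (delta_mx ord0 j); rewrite /preactivation c0 !add0r.
  rewrite (bigD1 j)//= [X in _ + X]big1 ?addr0; last first.
    by move=> i /negbTE ij; rewrite mxE eqxx/= ij mulr0.
  rewrite mxE !eqxx mulr1 => ->; rewrite big1// => i _.
  by rewrite mxE mulr0.
move: n1; rewrite c0 normr0 add0r big1 => [|j _]; last by rewrite w0 normr0.
by move=> /eqP; rewrite eq_sym oner_eq0.
Unshelve. all: by end_near. Qed.

End cube.

(** * The gap left by a dead neuron *)

Section realize.
Context {R : realType} {d h : nat} (i0 : 'I_h) (beta : R).

(* The slot [i0] carries the affine part, shifted by a constant that keeps its
   preactivation nonnegative. *)
Lemma affine_plus_relu_network (A : 'rV[R]_d -> R) (w : 'I_h -> 'rV[R]_d)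
    (b c : 'I_h -> R) : affine A ->
  exists theta : 'rV[R]_(nparams d h), forall x : 'rV[R]_d,
    (forall j, `|x ord0 j| <= beta) ->
    network theta x = A x +
      \sum_(i | i != i0) c i * Num.max (preactivation (w i) (b i) x) 0.
Proof.
move=> aA; pose v : 'rV[R]_d := \row_j (A (delta_mx ord0 j) - A 0).
pose K := `|A 0| + \sum_j `|v ord0 j| * beta.
have [theta [W B C cc]] := network_params_surj
  (fun i => if i == i0 then v else w i)
  (fun i => if i == i0 then A 0 + K else b i)
  (fun i => if i == i0 then 1 else c i) (- K).
exists theta => x xb; rewrite networkE W B C cc (bigD1 i0)//= eqxx mul1r.
have Kx : preactivation v (A 0 + K) x = A x + K.
  by rewrite (affine_rowE x aA) /preactivation -/v addrAC.
have Ax : `|A x| <= K.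
  rewrite (affine_rowE x aA) -/v /preactivation (le_trans (ler_normD _ _))//.
  rewrite lerD2l (le_trans (ler_norm_sum _ _ _))//.
  by apply: ler_sum => j _; rewrite normrM ler_wpM2l.
rewrite Kx max_l; last by move: Ax; rewrite ler_norml => /andP[]; lra.
rewrite addrA [- K + _]addrC addrK; congr (_ + _).
by apply: eq_bigr => i /negbTE ->.
Qed.

End realize.

(** * Testing against small bumps *)

Section local.
Context {R : realType} {d : nat} (a b : R).
Context {disp} {Omega : measurableType disp}.
Context (P : probability Omega R) (X : Omega -> 'rV[R]_d).
Hypothesis mX : measurable_fun setT X.
Hypothesis Xab : forall w j, a <= X w ord0 j <= b.
Hypothesis Xsupp : forall x e, open_cube a b x -> 0 < e -> (0 < P (X @^-1` ball x e))%E.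

Definition bump_ind (t : 'rV[R]_d * R) (w : Omega) : R := (expbump t.1 t.2 (X w) < 1)%R%:R.

Lemma measurable_bump_set t : measurable [set w | expbump t.1 t.2 (X w) < 1].
Proof.
have m : measurable_fun setT (fun w => expbump t.1 t.2 (X w)).
  apply: (measurableT_comp _ mX).
  by apply: continuous_measurable_row; exact: continuous_expbump.
have := m measurableT `]-oo, 1[%classic (measurable_itv _); rewrite setTI.
by congr measurable; apply/seteqP; split => w /=; rewrite in_itv.
Qed.

Lemma bump_indE t : bump_ind t = \1_[set w | expbump t.1 t.2 (X w) < 1].
Proof.
apply/funext => w; rewrite /bump_ind indicE; congr (_%:R); congr nat_of_bool.
by apply/idP/idP; rewrite inE.
Qed.

Lemma measurable_bump_ind t : measurable_fun setT (bump_ind t).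
Proof. by rewrite bump_indE; apply: measurable_indic; exact: measurable_bump_set. Qed.

Lemma bump_ind_bound t w : `|bump_ind t w| <= 1.
Proof. by rewrite /bump_ind; case: (_ < _); rewrite ?normr1// normr0. Qed.

Lemma mean_bump_ind_gt0 x s : open_cube a b x -> 0 < mean P (bump_ind (x, s)).
Proof.
move=> Ox; have mA := measurable_bump_set (x, s).
have -> : mean P (bump_ind (x, s)) = fine (P [set w | expbump x s (X w) < 1]).
  rewrite bump_indE /mean /Rintegral; congr fine.
  by rewrite integral_indic//= setIT.
apply: fine_gt0; apply/andP; split; last first.
  by rewrite (le_lt_trans (probability_le1 P mA))// ltry.
have [e e0 H] := bump_near x s.
apply: (lt_le_trans (Xsupp Ox e0)); apply: le_measure.
- rewrite inE -[X in measurable X]setTI; apply: mX => //.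
  by apply: open_measurable_rV; exact: ball_open.
- by rewrite inE.
- by move=> w /= /H.
Qed.

(** If [D x] were nonzero, [D x * D y] would exceed [D x ^+ 2 / 2] near [x], and a sharp bump, which
    has positive mass, would give a positive mean. The factor [D x] treats both signs together; [Q]
    restricts the tests to bumps that see only [Q] within the cube. *)
Lemma bump_tests_zero (D : 'rV[R]_d -> R) (Q : set 'rV[R]_d) x :
  open_cube a b x -> rintegrable P (fun w => D (X w)) -> {for x, continuous D} -> nbhs x Q ->
  (forall s, 0 <= s ->
    (forall y, closed_cube a b y -> expbump x s y < 1 -> Q y) ->
    mean P (fun w => D (X w) * bump_ind (x, s) w) = 0) -> D x = 0.
Proof.
move=> Ox sD cD Qx HQ; apply/eqP/negPn/negP => Dx0.
have D2 : 0 < D x ^+ 2 by rewrite exprn_even_gt0.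
have near1 : \forall y \near x, D x ^+ 2 / 2 < D x * D y.
  have h : (fun y => D x * D y) @ x --> D x * D x by exact: (cvgMl_tmp cD).
  apply: (cvgr_gt _ h); rewrite -expr2; lra.
have : nbhs x (Q `&` [set y | D x ^+ 2 / 2 < D x * D y]) by exact: filterI.
move=> /nbhs_ballP[r /= r0 rQ].
have az j : a <= x ord0 j by have /andP[/ltW] := Ox j.
have [s s0 Hs] := bump_localize r0 az.
have loc y : closed_cube a b y -> expbump x s y < 1 -> Q y /\ D x ^+ 2 / 2 < D x * D y.
  move=> Cy bs; apply: rQ; apply/ball_rowP => // j; rewrite distrC; apply: Hs => // k.
  by have /andP[] := Cy k.
have E0 : mean P (fun w => D x * (D (X w) * bump_ind (x, s) w)) = 0.
  rewrite meanZ ?HQ ?mulr0// => [y Cy bs|]; first by have [] := loc y Cy bs.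
  apply: (rintegrable_le _ (rintegrable_norm sD)).
    by apply: measurable_funM; [exact: rintegrable_meas sD|exact: measurable_bump_ind].
  by move=> w; rewrite normrM ler_piMr// bump_ind_bound.
have sb : rintegrable P (bump_ind (x, s)).
  exact: (rintegrable_bounded P (measurable_bump_ind _) (bump_ind_bound _)).
have : mean P (fun w => (D x ^+ 2 / 2) * bump_ind (x, s) w) <=
    mean P (fun w => D x * (D (X w) * bump_ind (x, s) w)).
  apply: mean_le.
  - exact: rintegrableZ.
  - apply: rintegrableZ; apply: (rintegrable_le _ (rintegrable_norm sD)).
      by apply: measurable_funM; [exact: rintegrable_meas sD|exact: measurable_bump_ind].
    by move=> w; rewrite normrM ler_piMr// bump_ind_bound.
  - move=> w; rewrite mulrA /bump_ind /=.
    have [h|_] := boolP (expbump x s (X w) < 1); last by rewrite !mulr0.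
    by rewrite !mulr1; apply: ltW; apply: (proj2 (loc _ _ h)); exact: Xab.
rewrite E0 meanZ// leNgt => /negP; apply.
by rewrite mulr_gt0// ?mean_bump_ind_gt0// divr_gt0.
Qed.

Context (Y : Omega -> R) (f : 'rV[R]_d -> R).
Hypothesis cf : continuous f.
Hypothesis f_cond : exists2 Z : Omega -> R, is_cond_expectation P X Y Z &
  {ae P, forall w, Z w = f (X w)}.

Lemma measurable_target : measurable_fun setT (fun w => f (X w)).
Proof.
exact: (measurableT_comp (continuous_measurable_row cf) mX).
Qed.

Lemma rintegrable_target : rintegrable P (fun w => f (X w)).
Proof.
have [Z [_ iZ _ _] ZfX] := f_cond.
have /integrableP[_ Zoo] := iZ; apply/integrableP; split.
  by apply/measurable_EFinP; exact: measurable_target.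
rewrite (_ : integral _ _ _ = \int[P]_w `|(EFin \o Z) w|)%E//.
apply: ae_eq_integral => //.
- by apply: measurableT_comp => //; apply/measurable_EFinP; exact: measurable_target.
- by apply: measurableT_comp => //; exact: measurable_int iZ.
- by apply: filterS ZfX => w /= -> _.
Qed.

Lemma mean_cond_bump t : mean P (fun w => Y w * bump_ind t w) =
  mean P (fun w => f (X w) * bump_ind t w).
Proof.
have [Z [iY iZ _ YZ] ZfX] := f_cond.
set A := [set w | expbump t.1 t.2 (X w) < 1].
have mA : measurable A := measurable_bump_set t.
have restrE (g : Omega -> R) : mean P (fun w => g w * bump_ind t w) =
    fine (\int[P]_(w in A) (g w)%:E)%E.
  rewrite /mean /Rintegral [in RHS]integral_mkcond; congr fine; apply: eq_integral => w _.
  rewrite patchE bump_indE indicE; case: (w \in A); first by rewrite mulr1.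
  by rewrite mulr0.
rewrite !restrE; congr fine.
have sA : preimage_set_system setT X measurable A.
  exists [set x | expbump t.1 t.2 x < 1]; last by rewrite setTI.
  rewrite (_ : [set x | _] = expbump t.1 t.2 @^-1` `]-oo, 1[); last first.
    by apply/seteqP; split => x /=; rewrite in_itv.
  apply: open_measurable_rV; apply: open_comp; last exact: interval_open.
  by move=> x _; exact: continuous_expbump.
rewrite -(YZ A sA); apply: ae_eq_integral => //.
- by apply/measurable_EFinP; apply: measurable_funTS; exact: rintegrable_meas iZ.
- by apply/measurable_EFinP; apply: measurable_funTS; exact: measurable_target.
- by apply: filterS ZfX => w /= -> _.
Qed.

End local.

Section loss_gap.
Context {R : realType} {d h : nat} (i0 : 'I_h) (a b : R).
Hypothesis ab : a < b.
Context {disp} {Omega : measurableType disp}.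
Context (P : probability Omega R) (X : Omega -> 'rV[R]_d) (Y : Omega -> R).
Hypothesis mX : measurable_fun setT X.
Hypothesis mY : measurable_fun setT Y.
Hypothesis Xab : forall w j, a <= X w ord0 j <= b.
Hypothesis Xsupp : forall x e, open_cube a b x -> 0 < e -> (0 < P (X @^-1` ball x e))%E.
Context (L : 'rV[R]_(nparams d h) -> R).
Hypothesis LE : forall theta, (L theta)%:E =
  'E_P[(fun w => `|network theta (X w) - Y w| ^+ 2)%R]%E.
Context (f : 'rV[R]_d -> R).
Hypothesis cf : continuous f.
Hypothesis f_cond : exists2 Z : Omega -> R, is_cond_expectation P X Y Z &
  {ae P, forall w, Z w = f (X w)}.
Hypothesis f_not_network : forall theta : 'rV[R]_(nparams d h),
  ~ {in closed_cube a b, f =1 network theta}.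

Let beta := `|a| + `|b|.

Lemma closed_cube_bound (x : 'rV[R]_d) j : closed_cube a b x -> `|x ord0 j| <= beta.
Proof.
move=> /(_ j) /andP[x1 x2]; rewrite /beta ler_norml.
have := ler_norm a; have := ler_norm (- a); have := ler_norm b; have := ler_norm (- b).
have := normr_ge0 a; have := normr_ge0 b.
by rewrite !normrN => *; apply/andP; split; lra.
Qed.

(** The level [v] passes to the lower limit of losses along dead parameters, while [theta'] keeps
    the infimum strictly below [v]. The negation is exactly the hypothesis that makes the
    near-minimizer filter proper. *)
Lemma loss_gap : exists v theta', L theta' < v /\
  forall theta, dead beta theta i0 -> v <= L theta.
Proof.
apply: contrapT => noex.
pose D0 : set 'rV[R]_(nparams d h) := [set theta | dead beta theta i0].
have noGap v theta' : L theta' < v -> exists2 theta, D0 theta & L theta < v.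
  move=> Lv; apply: contrapT => nex; apply: noex; exists v, theta'; split => // theta de.
  by rewrite leNgt; apply/negP => lv; apply: nex; exists theta.
have [U [UU NU]] := ultraFilterLemma
  (near_minimizers_proper (loss_ge0 LE) noGap).
have UF := @ultra_proper _ _ UU.
have Xbeta w j : `|X w ord0 j| <= beta by apply: closed_cube_bound => k; exact: Xab.
have mres := measurable_residual mX mY (h := h).
have sres := rintegrable_residual_sqr mX mY LE.
have Udead : \forall theta \near U, dead beta theta i0.
  by apply: filterS (NU _ (near_minimizersP L D0 ltr01)) => theta [].
have resC : \forall theta \near U,
    mean P (fun w => residual X Y theta w ^+ 2) <= L 0 + 1.
  apply: filterS (NU _ (near_minimizersP L D0 ltr01)) => theta [_ H].
  by rewrite (mean_residual_sqr LE).
have relu0 := near_minimizers_weak_null mX mY Xbeta LE UF NU.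
have bump0 z s : 0 <= s -> weak_null P U (residual X Y) (bump_ind X (z, s)).
  by move=> s0; exact: (weak_null_bump UF mres sres resC Xbeta relu0 z s0).
have /choice[lw /choice[lb lim]] := ultra_neuron_limit UU beta.
pose u i x := preactivation (lw i) (lb i) x.
(* Tests are a center and a sharpness such that, on the part of the cube seen by the bump, every
   limit preactivation except that of [i0] is bounded away from 0. *)
pose D : set ('rV[R]_d * R) := [set t | 0 <= t.2 /\
  forall i, i != i0 -> exists2 e, 0 < e &
    forall x, closed_cube a b x -> expbump t.1 t.2 x < 1 -> e <= `|u i x|].
(* The free index [i0] accounts for the affine part. *)
pose chi i x : R := if i == i0 then 1 else (0 < u i x)%R%:R.
pose al (p : 'I_h * 'I_d.+1) (theta : 'rV[R]_(nparams d h)) : R :=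
  if p.1 == i0 then (if p.2 == ord0 then outb theta else 0) else neuron_coef theta p.1 p.2.
pose g (p : 'I_h * 'I_d.+1) t :=
  mean P (fun w => chi p.1 (X w) * aff_coord p.2 (X w) * bump_ind X t w).
pose N (theta : 'rV[R]_(nparams d h)) t := mean P (fun w => network theta (X w) * bump_ind X t w).
have mchi i : measurable_fun setT (fun w => chi i (X w)).
  rewrite /chi; case: (i == i0) => //.
  have mu : measurable_fun setT (fun w => u i (X w)).
    by apply: (measurableT_comp (continuous_measurable_row (@continuous_preactivation _ _ _ _)) mX).
  rewrite [X in measurable_fun _ X](_ : _ =
    \1_(fun r : R => `]0, +oo[%classic r) \o (fun w => u i (X w))).
    by apply: measurableT_comp => //; apply: measurable_indic; exact: measurable_itv.
  apply/funext => w /=; rewrite indicE; congr (nat_of_bool _)%:R.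
  by apply/idP/idP; rewrite inE /= in_itv/= andbT.
have maff k : measurable_fun setT (fun w => aff_coord k (X w)).
  rewrite /aff_coord; case: (unlift ord0 k) => //= j.
  exact: (measurableT_comp (measurable_coord_rV j) mX).
have bchi i w : `|chi i (X w)| <= 1.
  by rewrite /chi; case: ifP => _; [rewrite normr1|case: (_ < _); rewrite ?normr1// normr0].
have baff k w : `|aff_coord k (X w)| <= 1 + beta.
  have b0 : 0 <= beta by rewrite addr_ge0.
  rewrite /aff_coord; case: (unlift ord0 k) => /= [j|]; last by rewrite normr1 lerDl.
  by rewrite (le_trans (Xbeta w j))// lerDr.
have mb t := measurable_bump_ind mX t.
have sg p t : rintegrable P (fun w => chi p.1 (X w) * aff_coord p.2 (X w) * bump_ind X t w).
  apply: (rintegrable_bounded P (M := 1 * (1 + beta) * 1)).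
    apply: measurable_funM; last exact: mb.
    exact: measurable_funM.
  move=> w; rewrite !normrM; apply: ler_pM => //; last exact: bump_ind_bound.
  by apply: ler_pM.
have bi2 t : rintegrable P (fun w => bump_ind X t w ^+ 2).
  by apply: rintegrable_sqr_bounded (bump_ind_bound X t); exact: mb.
have sY t : rintegrable P (fun w => Y w * bump_ind X t w).
  by apply: rintegrableM => //; exact: (rintegrable_Y_sqr mX mY LE).
have sR (theta : 'rV[R]_(nparams d h)) t :
    rintegrable P (fun w => residual X Y theta w * bump_ind X t w).
  exact: (rintegrableM (mres theta) (mb t) (sres theta) (bi2 t)).
(* The network is [Y] minus the residual, and the residual is asymptotically orthogonal to bumps. *)
have H1 t : D t -> N theta t @[theta --> U] --> mean P (fun w => Y w * bump_ind X t w).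
  case: t => z s [/= s0 _]; have [_ _ c0] := bump0 z s s0.
  have c1 : mean P (fun w => Y w * bump_ind X (z, s) w) -
      mean P (fun w => residual X Y theta w * bump_ind X (z, s) w) @[theta --> U] -->
      mean P (fun w => Y w * bump_ind X (z, s) w) - 0.
    by apply: cvgB => //; exact: cvg_cst.
  rewrite subr0 in c1; apply: cvg_trans c1; apply: near_eq_cvg; apply: nearW => theta.
  rewrite -meanB//; congr mean; apply/funext => w; rewrite /residual; ring.
(* On the part of the cube seen by the bump every neuron except [i0] eventually coincides with an
   affine function on its limit half space and 0 elsewhere, and [i0] contributes nothing; so the
   equality is exact. *)
have H2 t : D t -> \forall theta \near U,
    N theta t = \sum_(p <- index_enum ('I_h * 'I_d.+1)%type) al p theta * g p t.
  move=> [t0 eD]; near=> theta.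
  have de : dead beta theta i0 by near: theta.
  have lim' : forall i, i \in enum 'I_h -> i != i0 ->
      forall x, closed_cube a b x -> expbump t.1 t.2 x < 1 ->
      outw theta i * Num.max (preactivation (weights theta i) (bias theta i) x) 0 =
      if 0 < preactivation (lw i) (lb i) x then
        \sum_k neuron_coef theta i k * aff_coord k x else 0.
    near: theta; apply: near_all => i _.
    have [->|ii0] := eqVneq i i0; first by apply: nearW.
    have [e e0 he] := eD i ii0.
    apply: filterS (proj2 (lim i) e e0) => theta H _ x Cx bx; apply: H.
      by move=> j; exact: closed_cube_bound.
    exact: he.
  rewrite /g; under [RHS]eq_bigr do rewrite -meanZ//.
  rewrite -mean_sum; last by move=> p; exact: rintegrableZ.
  congr mean; apply/funext => w.
  have [h1|h1] := boolP (expbump t.1 t.2 (X w) < 1); last first.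
    rewrite /bump_ind (negbTE h1) mulr0 big1// => p _; rewrite !mulr0//.
  rewrite /bump_ind h1 mulr1; under eq_bigr do rewrite mulr1.
  rewrite -(pair_bigA _ (fun i k => al (i, k) theta * (chi i (X w) * aff_coord k (X w))))/=.
  rewrite networkE (bigD1 i0)//= (dead_preactivation de)// mulr0 add0r.
  rewrite [in RHS](bigD1 i0)//=; congr (_ + _).
    rewrite (bigD1 ord0)//= big1 ?addr0; last first.
      by move=> k /negbTE k0; rewrite /al /= eqxx k0 mul0r.
    by rewrite /al /chi /= !eqxx /aff_coord unlift_none/= !mulr1.
  apply: eq_bigr => i ii0; rewrite lim' ?mem_enum//.
  rewrite /al /chi /= (negbTE ii0); case: (0 < _).
    by apply: eq_bigr => k _; rewrite mul1r.
  by rewrite big1// => k _; rewrite mul0r mulr0.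
(* The tests play the role of points: weak convergence is pointwise convergence on [D]. *)
have [c cE] := span_pointwise_closed UF (index_enum_uniq _) H1 H2.
pose A i x := \sum_k c (i, k) * aff_coord k x.
have aA i : affine (A i).
  apply: affine_sum => k _; apply: affineZ; rewrite /aff_coord.
  case: (unlift ord0 k) => /= [j|]; last exact: affine_cst.
  by move=> t x y; rewrite !mxE subr0.
have cA i : continuous (A i).
  rewrite (_ : A i = preactivation (\row_j (A i (delta_mx ord0 j) - A i 0)) (A i 0)).
    exact: continuous_preactivation.
  by apply/funext => x; exact: affine_rowE.
have cu i : continuous (u i) by exact: continuous_preactivation.
pose W x := \sum_i chi i x * A i x.
have sA i : rintegrable P (fun w => A i (X w)).
  apply: rintegrable_sum => k; apply: rintegrableZ.
  exact: (rintegrable_bounded P (maff k) (baff k)).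
have sf := rintegrable_target mX cf f_cond.
have fW t : D t -> mean P (fun w => (f (X w) - W (X w)) * bump_ind X t w) = 0.
  move=> Dt; have := cE t Dt; rewrite (mean_cond_bump mX cf f_cond) /g.
  under [RHS]eq_bigr do rewrite -meanZ//.
  rewrite -mean_sum; last by move=> p; exact: rintegrableZ.
  move=> E.
  have sfb : rintegrable P (fun w => f (X w) * bump_ind X t w).
    apply: (rintegrable_le _ (rintegrable_norm sf)).
      by apply: measurable_funM; [exact: rintegrable_meas sf|exact: mb].
    by move=> w; rewrite normrM ler_piMr// bump_ind_bound.
  have -> : (fun w => (f (X w) - W (X w)) * bump_ind X t w) =
      fun w => f (X w) * bump_ind X t w - \sum_(p <- index_enum ('I_h * 'I_d.+1)%type)
        c p * (chi p.1 (X w) * aff_coord p.2 (X w) * bump_ind X t w).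
    apply/funext => w; rewrite mulrBl; congr (_ - _).
    rewrite [RHS](eq_bigr (fun p => c (p.1, p.2) *
      (chi p.1 (X w) * aff_coord p.2 (X w) * bump_ind X t w))); last by case.
    rewrite -(pair_bigA _ (fun i k => c (i, k) *
      (chi i (X w) * aff_coord k (X w) * bump_ind X t w)))/= /W mulr_suml.
    apply: eq_bigr => i _; rewrite /A mulr_sumr mulr_suml.
    by apply: eq_bigr => k _; ring.
  rewrite meanB//; first by rewrite E subrr.
  by apply: rintegrable_sum => p; exact: rintegrableZ.
have eqG x : open_cube a b x -> (forall i, i != i0 -> u i x != 0) -> f x = W x.
  (* [Wx] is [W] with its signs frozen at [x]: it is continuous and agrees with [W] on [Q]. The
     margin [|u i x| / 2] in [Q] is what places sharp bumps at [x] in [D]. *)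
  move=> Ox ux; pose Wx y := A i0 y + \sum_i (i != i0)%:R * (0 < u i x)%R%:R * A i y.
  pose Q : set 'rV[R]_d := [set y | forall i, i \in enum 'I_h -> i != i0 ->
    `|u i x| / 2 <= `|u i y| /\ (0 < u i y) = (0 < u i x)].
  have WE y : (forall i, i != i0 -> (0 < u i y) = (0 < u i x)) -> W y = Wx y.
    move=> H; rewrite /W /Wx (bigD1 i0)//= /chi eqxx mul1r; congr (_ + _).
    rewrite big_mkcond; apply: eq_bigr => i _.
    by case: ifPn => [ii0|_]; rewrite ?(negbTE ii0) ?H// ?mul1r// !mul0r.
  have cWx : continuous Wx.
    move=> y.
    have hi i : (fun z => (i != i0)%:R * (0 < u i x)%R%:R * A i z) @ y -->
        (i != i0)%:R * (0 < u i x)%R%:R * A i y.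
      exact: (cvgMl_tmp (cA i y)).
    exact: (cvgD (cA i0 y) (cvg_sumr _ hi)).
  apply/eqP; rewrite -subr_eq0 WE//; apply/eqP.
  apply: (bump_tests_zero mX Xab Xsupp (D := fun y => f y - Wx y) (Q := Q) Ox).
  - have := rintegrableD sf (rintegrableZ (- 1) (rintegrableD (sA i0) (rintegrable_sum
      (index_enum 'I_h) (fun i => rintegrableZ ((i != i0)%:R * (0 < u i x)%R%:R) (sA i))))).
    by congr rintegrable; apply/funext => w; rewrite mulN1r.
  - exact: (cvgB (@cf x) (cWx x)).
  - apply: (@near_all _ (nbhs x) _ _ _ (fun i y => i != i0 ->
      `|u i x| / 2 <= `|u i y| /\ (0 < u i y) = (0 < u i x))) => i _.
    have [->|ii0] := eqVneq i i0.
      by apply: nearW.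
    have e0 : 0 < `|u i x| / 2 by rewrite divr_gt0// normr_gt0 ux.
    have /cvgrPdist_lt/(_ _ e0) := cu i x.
    apply: filterS => y H _; move: H; have := ux i ii0.
    have [ux0|ux0|//] := ltgtP (u i x) 0 => _.
      rewrite ltr_norml => /andP[h1 h2].
      have uy : u i y < 0 by rewrite ler0_norm ?(ltW ux0) in h1 h2; lra.
      split; last by apply/negbTE; rewrite -leNgt ltW.
      rewrite (ler0_norm (ltW uy)); rewrite ler0_norm ?(ltW ux0)// in h1 h2 *; lra.
    rewrite ltr_norml => /andP[h1 h2].
    have uy : 0 < u i y by rewrite gtr0_norm// in h1 h2; lra.
    split; last by rewrite uy.
    rewrite (gtr0_norm uy); rewrite gtr0_norm// in h1 h2 *; lra.
  - move=> s s0 HQ.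
    have Dxs : D (x, s).
      split => // i ii0; exists (`|u i x| / 2); first by rewrite divr_gt0// normr_gt0 ux.
      by move=> y Cy by_; have [] := HQ y Cy by_ i (mem_enum _ _) ii0.
    rewrite -[RHS](fW _ Dxs); congr mean; apply/funext => w.
    have [h1|h1] := boolP (expbump x s (X w) < 1); last first.
      by rewrite /bump_ind /= (negbTE h1) !mulr0.
    rewrite WE// => i ii0.
    by have [] := HQ (X w) (Xab w) h1 i (mem_enum _ _) ii0.
pose r := [seq i <- enum 'I_h | i != i0].
have rE i : (i \in r) = (i != i0) by rewrite mem_filter mem_enum andbT.
have sumr (F : 'I_h -> R) : \sum_(i <- r) F i = \sum_(i | i != i0) F i.
  by rewrite big_filter big_enum_cond/=.
have [||||||||A' [c' [aA' fA']]] := @continuous_piecewise_affine R _ _ r (open_cube a b) u A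
    (A i0) f (line_open_cube ab) (@line_convex_cube R d a b).
- by exists (const_mx ((a + b) / 2)); exact: open_cube_center.
- by rewrite filter_uniq// enum_uniq.
- by move=> i _; exact: affine_preactivation.
- by move=> i _; apply: affine_neq0_cube => //; have [] := lim i.
- by move=> i _; exact: aA.
- exact: aA.
- by move=> x v _; apply: line_cvg; exact: cf.
- move=> x Ox ux; rewrite eqG//; last by move=> i; rewrite -rE; exact: ux.
  rewrite /W (bigD1 i0)//= sumr /chi eqxx mul1r; congr (_ + _).
  apply: eq_bigr => i /negbTE ->; case: (0 < u i x); first by rewrite mul1r.
  by rewrite mul0r.
have [theta th] := affine_plus_relu_network i0 beta lw lb c' aA'.
apply: (f_not_network (theta := theta)).
apply: (eq_closed_cube ab cf (@continuous_network _ _ _ theta)) => x.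
rewrite inE => Ox; rewrite fA'// sumr th// => j; apply: closed_cube_bound => k.
by have /andP[/ltW -> /ltW ->] := Ox k.
Unshelve. all: by end_near. Qed.

End loss_gap.

(** * Dead neurons stay dead *)

Section locally_constant.
Context {R : realType} {V W : normedModType R}.

(** The gradient is prescribed only where the loss is differentiable in the parameters of the
    neuron, so differentiability itself has to be established at dead neurons. *)
Lemma near_cst_differentiable (f : V -> W) x :
  (\forall y \near x, f y = f x) -> differentiable f x.
Proof.
move=> fx.
have E : f \o shift x = cst (f x) + (\0 : V -> W) +o_ (0:V) id.
  apply/eqaddoP => e e0; near=> y.
  rewrite !fctE /= addr0 (_ : f (y + x) = f x) ?subrr ?normr0 ?mulr_ge0//; first exact: ltW.
  near: y; have h : y + x @[y --> (0:V)] --> x.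
    have : y + x @[y --> (0:V)] --> 0 + x by apply: cvgD; [exact: cvg_id|exact: cvg_cst].
    by rewrite add0r.
  exact: (h _ fx).
have c0 : continuous (\0 : V -> W) by exact: cst_continuous.
apply/diff_locallyP; have D := diff_unique c0 E.
by rewrite D; split.
Unshelve. all: by end_near. Qed.

Lemma derive_line_cst (f : V -> W) x v :
  (\forall t \near (0:R), f (t *: v + x) = f x) -> 'D_v f x = 0.
Proof.
move=> fx; rewrite /derive; apply/cvg_lim => //.
apply: cvg_near_cst; apply: cvg_within; apply: filterS fx => t /= ->.
by rewrite subrr scaler0.
Qed.

End locally_constant.

Section dead_invariance.
Context {R : realType} {d h : nat} (beta : R).
Implicit Types (theta : 'rV[R]_(nparams d h)) (x : 'rV[R]_d) (i : 'I_h).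

Definition agree_off i theta theta' := forall k : 'I_(nparams d h),
  ~~ neuron_index (d := d) i k -> theta ord0 k = theta' ord0 k.

Lemma agree_off_param i theta theta' k : agree_off i theta theta' ->
  (k < nparams d h)%N -> ~~ neuron_index (d := d) i k -> param theta k = param theta' k.
Proof. by move=> ag kn ni; apply: ag; rewrite inordK. Qed.

Lemma network_agree_off i theta theta' x : agree_off i theta theta' ->
  dead beta theta i -> dead beta theta' i -> (forall j, `|x ord0 j| <= beta) ->
  network theta x = network theta' x.
Proof.
move=> ag de de' xb; rewrite !networkE.
have li := ltn_ord i.
have ob : outb theta = outb theta'.
  apply: (agree_off_param ag); first by rewrite /nparams; lia.
  by rewrite /neuron_index; nia.
rewrite ob; congr (_ + _); apply: eq_bigr => k _; have lk := ltn_ord k.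
have [->|ki] := eqVneq k i; first by rewrite !(dead_preactivation (beta := beta))// !mulr0.
have nki : (k <> i :> nat) by move=> /val_inj ki'; rewrite ki' eqxx in ki.
have -> : outw theta k = outw theta' k.
  by apply: (agree_off_param ag); rewrite /nparams /neuron_index; nia.
have -> : bias theta k = bias theta' k.
  by apply: (agree_off_param ag); rewrite /nparams /neuron_index; nia.
have -> // : weights theta k = weights theta' k.
apply/rowP => j; rewrite !mxE; have lj := ltn_ord j.
apply: (agree_off_param ag); rewrite /nparams /neuron_index; nia.
Qed.

Lemma agree_off_set_neuron i theta psi : agree_off i (set_neuron theta i psi) theta.
Proof.
by move=> k; rewrite /neuron_index negb_or mxE => /andP[/negbTE -> /negbTE ->].
Qed.

Lemma neuron_index_lt i j : (j < d)%N -> (i * d + j < nparams d h)%N.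
Proof. by move=> jd; have := ltn_ord i; rewrite /nparams; nia. Qed.

Lemma weights_set_neuron i theta psi j :
  weights (set_neuron theta i psi) i ord0 j = psi ord0 (inord j).
Proof.
have lj := ltn_ord j.
rewrite mxE /param mxE inordK ?neuron_index_lt// leq_addr ltn_add2l lj/=.
by rewrite addKn.
Qed.

Lemma bias_set_neuron i theta psi : bias (set_neuron theta i psi) i = psi ord0 ord_max.
Proof.
have li := ltn_ord i.
rewrite /bias /param mxE inordK; last by rewrite /nparams; lia.
rewrite ifN; last by nia.
by rewrite ifT// (mulnC h d).
Qed.

Lemma near_dead_set_neuron i theta : dead beta theta i ->
  \forall psi \near neuron_params theta i, dead beta (set_neuron theta i psi) i.
Proof.
move=> de; pose F (psi : 'rV[R]_d.+1) : R :=
  psi ord0 ord_max + \sum_(j < d) `|psi ord0 (inord j)| * beta.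
have cF : F @ neuron_params theta i --> F (neuron_params theta i).
  have hj (j : 'I_d) : (fun psi : 'rV[R]_d.+1 => `|psi ord0 (inord j)| * beta) @
      neuron_params theta i --> `|neuron_params theta i ord0 (inord j)| * beta.
    exact: (cvgMr_tmp (cvg_norm (@coord_continuous R 1 d.+1 ord0 (inord j) _))).
  exact: (cvgD (@coord_continuous R 1 d.+1 ord0 ord_max _) (cvg_sumr _ hj)).
have F0 : F (neuron_params theta i) < 0.
  move: de; rewrite /dead /F; congr (_ < _); congr (_ + _).
    by rewrite mxE ltnn /bias mulnC.
  apply: eq_bigr => j _; congr (`| _ | * _).
  by rewrite !mxE inordK ?(ltn_ord j) ?(ltnW (ltn_ord j))// ltnS ltnW.
apply: filterS (cvgr_lt _ cF _ F0) => psi; rewrite /dead /F bias_set_neuron.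
by under [in X in _ -> X]eq_bigr do rewrite weights_set_neuron.
Qed.

Lemma agree_off_line i theta (j : 'I_(nparams d h)) (t : R) : neuron_index (d := d) i j ->
  agree_off i (t *: delta_mx ord0 j + theta) theta.
Proof.
move=> ij k ik; rewrite !mxE; case: (eqVneq k j) => [kj|]; last first.
  by rewrite andbF mulr0 add0r.
by rewrite kj ij in ik.
Qed.

Lemma near_dead_line i theta (v : 'rV[R]_(nparams d h)) : dead beta theta i ->
  \forall t \near (0:R), dead beta (t *: v + theta) i.
Proof.
move=> de; pose F t : R := (t * bias v i + bias theta i) +
  \sum_(j < d) `|t * weights v i ord0 j + weights theta i ord0 j| * beta.
have cl (p r : R) : (t * p + r) @[t --> (0:R)] --> 0 * p + r.
  by apply: cvgD; [apply: cvgMr_tmp; exact: cvg_id|exact: cvg_cst].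
have cF : F @ (0:R) --> F 0.
  have hj j : `|t * weights v i ord0 j + weights theta i ord0 j| * beta @[t --> (0:R)] -->
      `|0 * weights v i ord0 j + weights theta i ord0 j| * beta.
    exact: (cvgMr_tmp (cvg_norm (cl _ _))).
  exact: (cvgD (cl _ _) (cvg_sumr _ hj)).
have F0 : F 0 < 0.
  move: de; rewrite /dead /F mul0r add0r; congr (_ + _ < _).
  by apply: eq_bigr => j _; rewrite mul0r add0r.
apply: filterS (cvgr_lt _ cF _ F0) => t; rewrite /dead /F; congr (_ + _ < _).
  by rewrite /bias /param !mxE.
by apply: eq_bigr => j _; rewrite !mxE /param !mxE.
Qed.

End dead_invariance.

Section sgd_step.
Context {R : realType} {d h : nat} (beta : R) {Omega : Type}.
Context (M : nat) (X : nat -> Omega -> 'rV[R]_d) (Y : nat -> Omega -> R).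
Hypothesis Xbeta : forall m w j, `|X m w ord0 j| <= beta.
Context (fL : 'rV[R]_(nparams d h) -> Omega -> R).
Hypothesis fLE : forall theta w, fL theta w = M%:R^-1 *
  \sum_(1 <= m < M.+1) `|network theta (X m w) - Y m w| ^+ 2.
Context (G : 'rV[R]_(nparams d h) -> Omega -> 'rV[R]_(nparams d h)).
Hypothesis GE : forall (i : 'I_h) (j : 'I_(nparams d h)), neuron_index (d := d) i j ->
  forall theta w,
  differentiable (fun psi : 'rV[R]_d.+1 => fL (set_neuron theta i psi) w)
    (neuron_params theta i) ->
  G theta w ord0 j = 'D_(delta_mx ord0 j) (fun theta' => fL theta' w) theta.

Lemma loss_agree_off i theta theta' w : agree_off i theta theta' ->
  dead beta theta i -> dead beta theta' i -> fL theta w = fL theta' w.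
Proof.
move=> ag de de'; rewrite !fLE; congr (_ * _); apply: eq_bigr => m _.
by rewrite (network_agree_off ag de de').
Qed.

(** Local constancy is used twice: in all inner parameters of the neuron, for the differentiability
    that gives access to [GE], and along the [j]-th axis, for the partial derivative. *)
Lemma dead_gradient i (j : 'I_(nparams d h)) theta w : dead beta theta i ->
  neuron_index (d := d) i j -> G theta w ord0 j = 0.
Proof.
move=> de ij.
have H psi : dead beta (set_neuron theta i psi) i ->
    fL (set_neuron theta i psi) w = fL theta w.
  by move=> de'; apply: (loss_agree_off w (agree_off_set_neuron theta psi)).
rewrite (GE ij); last first.
  apply: near_cst_differentiable.
  rewrite (H (neuron_params theta i)); last exact: nbhs_singleton (near_dead_set_neuron de).
  by apply: filterS (near_dead_set_neuron de) => psi; exact: H.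
apply: derive_line_cst.
apply: filterS (near_dead_line (delta_mx ord0 j) de) => t de'.
by apply: (loss_agree_off w (agree_off_line theta t ij)).
Qed.

(** Only inner parameters enter [dead], and these do not move at all, whatever the step size; the
    output weight of the neuron is free to change. *)
Lemma dead_sgd_step i theta w (gamma : R) : dead beta theta i ->
  dead beta (theta - gamma *: G theta w) i.
Proof.
move=> de; have li := ltn_ord i.
have G0 k : (k < nparams d h)%N -> neuron_index (d := d) i k ->
    param (theta - gamma *: G theta w) k = param theta k.
  by move=> kn ki; rewrite /param !mxE (dead_gradient w de) ?inordK// mulr0 subr0.
move: de; rewrite /dead; congr (_ + _ < _).
  rewrite /bias G0//; first by rewrite /nparams; lia.
  by rewrite /neuron_index (mulnC h d) eqxx orbT.
apply: eq_bigr => j _; rewrite !mxE -[in RHS]/(param _ _) G0 ?neuron_index_lt//.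
by rewrite /neuron_index leq_addr ltn_add2l ltn_ord.
Qed.

End sgd_step.

(** * Dead neurons at initialization *)

Section independent_events.
Context {disp} {Omega : measurableType disp} {R : realType} (P : probability Omega R).
Context {I : finType} (E : I -> set Omega) (c : R).
Hypothesis mE : forall i, measurable (E i).
Hypothesis PE : forall S : {set I}, P (\bigcap_(i in [set` S]) E i) = (c ^+ #|S|)%:E.

Let mcap (S : {set I}) : measurable (\bigcap_(i in [set` S]) E i).
Proof. by apply: fin_bigcap_measurable => // i _; exact: mE. Qed.

Let none (l : seq I) : set Omega := [set w | forall i, i \in l -> ~ E i w].

Lemma measurable_none l : measurable (none l).
Proof.
have -> : none l = \bigcap_(i in [set` l]) ~` E i.
  by apply/seteqP; split => w H i; exact: H.
by apply: fin_bigcap_measurable => // i _; exact: measurableC.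
Qed.

(** Carrying the set [S] of events that do occur makes the induction close: excluding one more event
    [E i] subtracts the same probability with [i] moved into [S]. *)
Lemma prob_none_all (l : seq I) (S : {set I}) : uniq l ->
  (forall i, i \in l -> i \notin S) ->
  P (none l `&` \bigcap_(i in [set` S]) E i) = ((1 - c) ^+ size l * c ^+ #|S|)%:E.
Proof.
elim: l S => [|i l IH] S /=.
  move=> _ _; rewrite expr0 mul1r -PE; congr (P _).
  by apply/seteqP; split => [w []//|w H]; split.
move=> /andP[il ul] lS.
have iS : i \notin S by apply: lS; exact: mem_head.
have lS' j : j \in l -> j \notin S by move=> jl; apply: lS; rewrite in_cons jl orbT.
have lS'' j : j \in l -> j \notin (i |: S)%SET.
  move=> jl; rewrite !inE negb_or lS'// andbT; apply/eqP => ji.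
  by rewrite -ji jl in il.
have := IH _ ul lS''; have := IH _ ul lS'.
set A := none l `&` \bigcap_(j in [set` S]) E j.
set B := none l `&` \bigcap_(j in [set` (i |: S)%SET]) E j.
move=> PA PB.
have BA : B `<=` A.
  by move=> w [n1 h1]; split => // j jS; apply: h1; rewrite /= !inE jS orbT.
have -> : none (i :: l) `&` \bigcap_(j in [set` S]) E j = A `\` B.
  apply/seteqP; split => [w [n1 h1]|w [[n1 h1] nB]].
    split.
      by split => // j jl; apply: n1; rewrite in_cons jl orbT.
    by move=> [_ h2]; apply: (n1 i (mem_head _ _)); apply: h2; rewrite /= !inE eqxx.
  split => // j; rewrite in_cons => /predU1P[->|]; last exact: n1.
  move=> Ei; apply: nB; split => // k; rewrite /= !inE => /predU1P[->//|kS].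
  exact: h1.
have mA : measurable A by apply: measurableI; [exact: measurable_none|exact: mcap].
have mB : measurable B by apply: measurableI; [exact: measurable_none|exact: mcap].
have PAoo : (P A < +oo)%E by rewrite PA ltry.
have -> : P (A `\` B) = (P A - P B)%E.
  by have := measureD mA mB PAoo; rewrite (setIidr BA).
rewrite PA PB -EFinB; congr EFin.
by rewrite cardsU1 iS/= exprS exprS; ring.
Qed.

Lemma prob_some : P (\bigcup_i E i) = (1 - (1 - c) ^+ #|I|)%:E.
Proof.
have -> : \bigcup_i E i = ~` (none (enum I) `&` \bigcap_(i in [set` (finset.set0 : {set I})]) E i).
  apply/seteqP; split => [w [i _ Ei] [n1 _]|w nn].
    by apply: (n1 i) => //; rewrite mem_enum.
  apply: contrapT => nE; apply: nn; split => [i _ Ei|i]; last by rewrite /= inE.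
  by apply: nE; exists i.
rewrite probability_setC; last first.
  by apply: measurableI; [exact: measurable_none|exact: mcap].
rewrite prob_none_all ?enum_uniq// => [|i _]; last by rewrite inE.
by rewrite cards0 expr0 mulr1 -cardE -EFinB.
Qed.

End independent_events.

Section initial_law.
Context {disp} {Omega : measurableType disp} {R : realType} (P : probability Omega R).
Context (q : R -> R).
Hypothesis q_meas : measurable_fun setT q.
Hypothesis q_ge0 : forall y, 0 <= q y.
Context (eta : R).
Hypothesis q_gt0 : forall y, - eta < y < eta -> 0 < q y.

Local Open Scope ereal_scope.

(** The law is given by strict inequalities, so differences of rays are closed on the left and open
    on the right. *)
Lemma law_itv (Z : Omega -> R) (s t : R) : measurable_fun setT Z -> (s <= t)%R ->
  (forall x : R, P [set w | (Z w < x)%R] =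
    \int[lebesgue_measure]_(y in `]-oo, x[) (q y)%:E) ->
  P (Z @^-1` `[s, t[) = \int[lebesgue_measure]_(y in `[s, t[) (q y)%:E.
Proof.
move=> mZ st law.
have mi (i : interval R) : measurable (Z @^-1` [set` i]).
  by rewrite -[X in measurable X]setTI; apply: mZ => //; exact: measurable_itv.
have ray x : [set w | (Z w < x)%R] = Z @^-1` `]-oo, x[.
  by apply/seteqP; split => w /=; rewrite in_itv.
have itvU : `]-oo, t[%classic = `]-oo, s[ `|` `[s, t[ :> set R.
  by apply: itv_bndbnd_setU; rewrite // bnd_simp.
have dis : [disjoint `]-oo, s[%classic & (`[s, t[%classic : set R)].
  apply/disj_set2P; apply/seteqP; split => // x [] /=; rewrite !in_itv/=.
  by move=> xs /andP[sx _]; move: (lt_le_trans xs sx); rewrite ltxx.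
have qE : \int[lebesgue_measure]_(y in `]-oo, t[) (q y)%:E =
    \int[lebesgue_measure]_(y in `]-oo, s[) (q y)%:E +
    \int[lebesgue_measure]_(y in `[s, t[) (q y)%:E.
  rewrite itvU ge0_integral_setU//.
  - by apply/measurable_EFinP; exact: measurable_funTS.
  - by move=> x _; rewrite lee_fin.
have PE : P [set w | (Z w < t)%R] = P [set w | (Z w < s)%R] + P (Z @^-1` `[s, t[).
  rewrite !ray itvU preimage_setU measureU//.
  by rewrite -preimage_setI; move/disj_set2P: dis => ->; rewrite preimage_set0.
have fs : \int[lebesgue_measure]_(y in `]-oo, s[) (q y)%:E \is a fin_num.
  by rewrite -law ray; exact: fin_num_measure.
move: PE; rewrite !law qE addeC [in RHS]addeC => /(congr1 (fun z =>
  z - \int[lebesgue_measure]_(y in `]-oo, s[) (q y)%:E)).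
by rewrite !addeK.
Qed.

Lemma law_itv_gt0 (s t : R) : (- eta < s)%R -> (s < t)%R -> (t <= eta)%R ->
  0 < \int[lebesgue_measure]_(y in `[s, t[) (q y)%:E.
Proof.
move=> es st te; rewrite lt_neqAle; apply/andP; split; last first.
  by apply: integral_ge0 => y _; rewrite lee_fin.
apply/eqP => /esym E0.
have mq : measurable_fun `[s, t[ (EFin \o q).
  by apply/measurable_EFinP; exact: measurable_funTS.
have h0 : \int[lebesgue_measure]_(y in `[s, t[) `|(EFin \o q) y| = 0.
  rewrite -[RHS]E0; apply: eq_integral => y _ /=.
  by rewrite ger0_norm.
have [N [mN N0 sub]] := (ae_eq_integral_abs (@lebesgue_measure R) (measurable_itv `[s, t[) mq).1 h0.
have sN : `[s, t[ `<=` N.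
  move=> y /= yst; apply: sub => /= /(_ yst) [].
  move: yst; rewrite in_itv/= => /andP[sy yt] q0.
  have := q_gt0 (y := y); rewrite q0 ltxx (lt_le_trans es sy) (lt_le_trans yt te).
  by move=> /(_ isT).
have : lebesgue_measure `[s, t[%classic <= lebesgue_measure N.
  by apply: le_measure => //; rewrite inE//; exact: measurable_itv.
rewrite N0 lebesgue_measure_itv/= lte_fin st.
by rewrite -EFinB lee_fin leNgt subr_gt0 st.
Qed.

End initial_law.

Section neuron_slots.
Context {d h : nat}.

Lemma slot_subproof (p : 'I_h * 'I_d.+1) :
  ((if p.2 < d then p.1 * d + p.2 else h * d + p.1) < h * d + h)%N.
Proof. by case: p => i k /=; have := ltn_ord i; case: ifP => kd li; nia. Qed.

(** Coordinate [k = d] of a neuron is its bias. Injectivity lets independence of the flat parameters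
    pass to independence of neurons. *)
Definition slot p : 'I_(h * d + h) := Ordinal (slot_subproof p).

Lemma slot_inj : injective slot.
Proof.
move=> [i k] [i' k'] /(congr1 val)/=.
have li := ltn_ord i; have li' := ltn_ord i'.
have lk := ltn_ord k; have lk' := ltn_ord k'.
have [kd|kd] := ltnP k d; have [kd'|kd'] := ltnP k' d => E.
- have ii' : i = i' :> nat by nia.
  have kk' : k = k' :> nat by nia.
  by congr pair; exact: val_inj.
- exfalso; nia.
- exfalso; nia.
- have ii' : i = i' :> nat by lia.
  have kk' : k = k' :> nat by lia.
  by congr pair; exact: val_inj.
Qed.

End neuron_slots.

Section initial_dead.
Context {disp} {Omega : measurableType disp} {R : realType} (P : probability Omega R).
Context (q : R -> R).
Hypothesis q_meas : measurable_fun setT q.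
Hypothesis q_ge0 : forall y, 0 <= q y.
Context (eta : R).
Hypothesis eta_gt0 : 0 < eta.
Hypothesis q_gt0 : forall y, - eta < y < eta -> 0 < q y.
Context (d : nat) (beta : R).
Hypothesis beta_ge0 : 0 <= beta.

(** Weights in this range contribute at most [eta / 4] to a preactivation, against a bias below
    [- (eta / 2)]; the [+ 1] also keeps the range itself within [eta / 4], where [q] is positive. *)
Definition weight_range : R := eta / (4 * (d%:R * beta + 1)).

Definition mass (s t : R) : R := fine (\int[lebesgue_measure]_(y in `[s, t[) (q y)%:E)%E.

(** The probability that the [d] rescaled weights and the rescaled bias of one neuron fall into
    ranges forcing deadness. It does not mention [h]. *)
Definition dead_mass : R := \prod_(k < d.+1)
  if (k < d)%N then mass (- weight_range) weight_range else mass (- (3 * eta / 4)) (- (eta / 2)).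

Let D1 : 0 < d%:R * beta + 1. Proof. by rewrite ltr_wpDl// mulr_ge0. Qed.

Let wr0 : 0 < weight_range. Proof. by rewrite divr_gt0// mulr_gt0. Qed.

Let wr_eta : weight_range <= eta / 4.
Proof.
rewrite /weight_range ler_pM2l// lef_pV2 ?posrE ?mulr_gt0//.
by rewrite ler_peMr// lerDr mulr_ge0.
Qed.

Let wr_sum : d%:R * (weight_range * beta) <= eta / 4.
Proof.
have -> : d%:R * (weight_range * beta) = eta / 4 * ((d%:R * beta) / (d%:R * beta + 1)).
  by rewrite /weight_range; field; rewrite gt_eqF.
rewrite ler_piMr ?divr_ge0 ?(ltW eta_gt0)// ler_pdivrMr// mul1r lerDl//.
Qed.

Context (h : nat) (h_gt0 : (0 < h)%N) (kappa : R).
Context (Theta : Omega -> 'rV[R]_(nparams d h)).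
Hypothesis mTheta : measurable_fun setT Theta.
Hypothesis Theta_indep : mutually_independent P
  (fun (i : 'I_(h * d + h)) w => param (Theta w) i).
Hypothesis Theta_law : forall (i : 'I_(h * d + h)) (x : R),
    (P [set w | (h%:R `^ kappa * param (Theta w) i < x)%R] =
      \int[lebesgue_measure]_(y in `]-oo, x[) (q y)%:E)%E.

Let sc : R := h%:R `^ kappa.
Let sc0 : 0 < sc. Proof. by rewrite powR_gt0// ltr0n. Qed.

Let rng (k : nat) : interval R :=
  if (k < h * d)%N then `[- weight_range, weight_range[ else `[- (3 * eta / 4), - (eta / 2)[.

Let dead_box (i : 'I_(h * d + h)) : set R := [set z | sc * z \in rng i].

Let m_param k : measurable_fun setT (fun w => param (Theta w) k).
Proof. exact: (measurableT_comp (measurable_coord_rV _) mTheta). Qed.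

Let m_dead_box i : measurable (dead_box i).
Proof.
have m : measurable_fun setT (fun z : R => sc * z) by exact: mulrl_measurable.
by have := m measurableT [set` rng i] (measurable_itv _); rewrite setTI.
Qed.

Let slot_mass (k : 'I_d.+1) : R :=
  if (k < d)%N then mass (- weight_range) weight_range else mass (- (3 * eta / 4)) (- (eta / 2)).

Let mass_law (k : 'I_(h * d + h)) s t : s <= t ->
  P ((fun w => sc * param (Theta w) k) @^-1` `[s, t[) = (mass s t)%:E.
Proof.
move=> st; have mZ : measurable_fun setT (fun w => sc * param (Theta w) k).
  exact: measurable_funM.
have E := law_itv q_meas q_ge0 mZ st (Theta_law k).
rewrite /mass -E fineK//; apply: fin_num_measure.
by rewrite -[X in measurable X]setTI; apply: mZ => //; exact: measurable_itv.
Qed.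

Let P_slot p : P ((fun w => param (Theta w) (slot p)) @^-1` dead_box (slot p)) =
  (slot_mass p.2)%:E.
Proof.
case: p => i k; have li := ltn_ord i; have lk := ltn_ord k.
have [kd|kd] := ltnP k d.
  have E : rng (slot (i, k)) = `[- weight_range, weight_range[.
    by rewrite /rng /= kd ifT//; nia.
  rewrite [slot_mass _](_ : _ = mass (- weight_range) weight_range); last by rewrite /slot_mass kd.
  rewrite -(mass_law (slot (i, k))); last by have := wr0; lra.
  by congr (P _); rewrite /preimage /dead_box E.
have E' : rng (slot (i, k)) = `[- (3 * eta / 4), - (eta / 2)[.
  by rewrite /rng /= [(k < d)%N]ltnNge kd/= ltnNge leq_addr.
rewrite [slot_mass _](_ : _ = mass (- (3 * eta / 4)) (- (eta / 2)));
  last by rewrite /slot_mass ltnNge kd.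
rewrite -(mass_law (slot (i, k))); last by have := eta_gt0; lra.
by congr (P _); rewrite /preimage /dead_box E'.
Qed.

Let ev (i : 'I_h) : set Omega :=
  \bigcap_(k : 'I_d.+1) ((fun w => param (Theta w) (slot (i, k))) @^-1` dead_box (slot (i, k))).

Let m_ev i : measurable (ev i).
Proof.
apply: fin_bigcap_measurable => // k _.
by rewrite -[X in measurable X]setTI; exact: m_param.
Qed.

Let P_ev (S : {set 'I_h}) : P (\bigcap_(i in [set` S]) ev i) = (dead_mass ^+ #|S|)%:E.
Proof.
have -> : \bigcap_(i in [set` S]) ev i =
    \bigcap_(k in [set` (slot @: (finset.setX S [set: 'I_d.+1]%SET))%SET])
      ((fun w => param (Theta w) k) @^-1` dead_box k).
  apply/seteqP; split => [w H k /= /imsetP[[i k']]|w H i /= iS k _].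
    by rewrite !inE andbT => /= iS ->; exact: H.
  by apply: H => /=; apply: imset_f; rewrite !inE iS.
rewrite (Theta_indep (fun i _ => m_dead_box i)).
rewrite big_imset/=; last by move=> p p' _ _; exact: slot_inj.
under eq_bigr do rewrite P_slot.
rewrite prodEFin; congr EFin.
rewrite (eq_bigl (fun p => (p.1 \in S) && true)); last by move=> p; rewrite !inE.
rewrite -(pair_big (fun i => i \in S) xpredT (fun i k => slot_mass k))/=.
by rewrite prodr_const.
Qed.

(** Since [fine] sends an infinite integral to 0, finiteness matters too; it comes from reading the
    integral as the probability of an event about one initial parameter. *)
Let mass_gt0 s t : - eta < s -> s < t -> t <= eta -> 0 < mass s t.
Proof.
move=> es st te.
have E := mass_law (slot (Ordinal h_gt0, ord0)) (ltW st).
have mZ : measurable_fun setT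
    (fun w => sc * param (Theta w) (slot (Ordinal h_gt0, (ord0 : 'I_d.+1)))).
  exact: measurable_funM.
have F := law_itv q_meas q_ge0 mZ (ltW st) (Theta_law _).
by rewrite -lte_fin -E F; exact: (law_itv_gt0 q_meas q_ge0 q_gt0).
Qed.

Lemma dead_mass_gt0 : 0 < dead_mass.
Proof.
have := wr0; have := wr_eta; have := eta_gt0 => e0 we w0.
by apply: prodr_gt0 => k _; case: ifP => _; apply: mass_gt0; lra.
Qed.

Lemma dead_mass_le1 : dead_mass <= 1.
Proof.
have := P_ev [set Ordinal h_gt0]%SET; rewrite cards1 expr1 => E.
rewrite -lee_fin -E; apply: probability_le1.
by apply: fin_bigcap_measurable => // i _; exact: m_ev.
Qed.

Lemma dead_at_init : exists A : set Omega, [/\ measurable A,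
  P A = (1 - (1 - dead_mass) ^+ h)%:E &
  A `<=` [set w | exists i, dead beta (Theta w) i]].
Proof.
exists (\bigcup_i ev i); split.
- by apply: fin_bigcup_measurable => // i _; exact: m_ev.
- by rewrite (prob_some m_ev P_ev) card_ord.
move=> w [i _ Ei]; exists i; rewrite /dead.
have li := ltn_ord i.
have wj (j : 'I_d) : `|sc * weights (Theta w) i ord0 j| <= weight_range.
  have lj := ltn_ord j.
  have := Ei (inord j) I; rewrite /dead_box /= inordK; last by rewrite ltnS ltnW.
  rewrite /rng lj ifT; last by nia.
  rewrite in_itv/= mxE ler_norml => /andP[-> h2].
  exact: ltW.
have bi : sc * bias (Theta w) i < - (eta / 2).
  have := Ei ord_max I; rewrite /dead_box /= ltnn /rng ifN; last by rewrite -leqNgt leq_addr.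
  by rewrite in_itv/= /bias (mulnC d h) => /andP[].
(* After multiplication by the positive scale, the bias is below [- (eta / 2)] and the weights add
   at most [eta / 4]. *)
rewrite -(pmulr_rlt0 _ sc0) mulrDr mulr_sumr.
have : \sum_(j < d) sc * (`|weights (Theta w) i ord0 j| * beta) <=
    \sum_(j < d) weight_range * beta.
  apply: ler_sum => j _; rewrite mulrA; apply: ler_wpM2r => //.
  by have := wj j; rewrite normrM (gtr0_norm sc0).
rewrite sumr_const card_ord -[X in _ <= X -> _]mulr_natl.
have := wr_sum; have := eta_gt0; lra.
Qed.

End initial_dead.

(** * Full support of the input, and measurability *)

Section density_support.
Context {R : realType} {d : nat} {disp} {Omega : measurableType disp}.
Context (P : probability Omega R) (X : Omega -> 'rV[R]_d) (p : 'rV[R]_d -> R).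
Hypothesis mX : measurable_fun setT X.
Hypothesis p_cont : continuous p.
Hypothesis X_density : forall A : set 'rV[R]_d, measurable A ->
  (P (X @^-1` A) = \int[lebesgue_rV d]_(x in A) (p x)%:E)%E.

Local Open Scope ereal_scope.

Lemma lebesgue_rV_ball (x : 'rV[R]_d) e : (0 < e)%R -> 0 < lebesgue_rV d (ball x e).
Proof.
move=> e0; have -> : ball x e = [set y : 'rV[R]_d | forall j,
    y ord0 j \in `]x ord0 j - e, x ord0 j + e[%R].
  apply/seteqP; split => [y /ball_rowP H j|y H].
    have := H e0 j; rewrite ltr_norml in_itv/= => /andP[h1 h2].
    by apply/andP; split; lra.
  apply/ball_rowP => // j; have := H j; rewrite in_itv/= ltr_norml => /andP[h1 h2].
  by apply/andP; split; lra.
rewrite lebesgue_rV_box; last by move=> j; lra.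
by rewrite lte_fin; apply: prodr_gt0 => j _; lra.
Qed.

Lemma integral_ball_ge (x : 'rV[R]_d) e (g : 'rV[R]_d -> R) (c : R) : (0 < e)%R ->
  (0 < c)%R -> continuous g -> (forall y, ball x e y -> (c <= g y)%R) ->
  0 < \int[lebesgue_rV d]_(y in ball x e) (g y)%:E.
Proof.
move=> e0 c0 cg cge; have mB : measurable (ball x e).
  by apply: open_measurable_rV; exact: ball_open.
apply: (@lt_le_trans _ _ (\int[lebesgue_rV d]_(y in ball x e) cst c%:E y)).
  by rewrite integral_cst// mule_gt0// lebesgue_rV_ball.
apply: ge0_le_integral => //.
- by move=> y _; rewrite lee_fin ltW.
- apply/measurable_EFinP; apply: measurable_funTS.
  exact: continuous_measurable_row.
Qed.

(** The sign of [p] is not given. If [p x] were negative, continuity would keep [p] below a negative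
    constant on a small ball, whose probability would then be negative. *)
Lemma density_support (x : 'rV[R]_d) e : p x != 0%R -> (0 < e)%R ->
  0 < P (X @^-1` ball x e).
Proof.
move=> px e0.
have H (g : 'rV[R]_d -> R) : continuous g -> (0 < g x)%R ->
    exists2 r, (0 < r <= e)%R & forall y, ball x r y -> (g x / 2 <= g y)%R.
  move=> cg gx; have : \forall y \near x, (g x / 2 < g y)%R.
    by apply: (cvgr_gt _ (cg x)); lra.
  move=> /nbhs_ballP[r /= r0 rg]; exists (Num.min r e).
    by rewrite lt_min r0 e0 ge_min lexx orbT.
  move=> y By; apply/ltW/rg; apply: le_ball By; by rewrite ge_min lexx.
have mB r : measurable (ball x r) by apply: open_measurable_rV; exact: ball_open.
have mXB r : measurable (X @^-1` ball x r).
  by rewrite -[X in measurable X]setTI; exact: mX.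
have sub r : (r <= e)%R -> P (X @^-1` ball x r) <= P (X @^-1` ball x e).
  move=> re; apply: le_measure; rewrite ?inE//.
  by move=> w /= Bw; exact: le_ball re _ Bw.
move: px; rewrite neq_lt => /orP[px|px].
  have cp : continuous (fun y => - p y)%R by move=> y; exact: (cvgN (@p_cont y)).
  have [|r /andP[r0 re] rp] := H (fun y => - p y)%R cp; first by rewrite oppr_gt0.
  have np : (0 < - p x / 2)%R by rewrite divr_gt0// oppr_gt0.
  have I0 := integral_ball_ge r0 np cp rp.
  have := X_density (mB r).
  rewrite (_ : (fun y => (p y)%:E) = (fun y => - (- p y)%:E)); last first.
    by apply/funext => y; rewrite EFinN oppeK.
  rewrite integral_ge0N; last first.
    by move=> y /rp h1; rewrite lee_fin (le_trans (ltW np)).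
  move=> PE; have : 0 <= P (X @^-1` ball x r) by [].
  by rewrite PE leeNr oppe0 leNgt I0.
have [r /andP[r0 re] rp] := H p p_cont px.
apply: (lt_le_trans _ (sub r re)); rewrite X_density//.
by apply: (integral_ball_ge r0 _ p_cont rp); rewrite divr_gt0.
Qed.

End density_support.

Section limits.
Context {R : realType}.

Lemma limn_einf_ge (u : (\bar R)^nat) (v : \bar R) : (forall n, v <= u n)%E ->
  (v <= limn_einf u)%E.
Proof.
move=> vu; rewrite limn_einf_lim; apply: lime_ge; first exact: is_cvg_einfs.
apply: nearW => n; rewrite /einfs/=; apply: le_ereal_inf_tmp => _ [k _ <-]; exact: vu.
Qed.

Lemma measurable_limn_einf {disp} {Omega : measurableType disp}
    (g : nat -> Omega -> \bar R) : (forall n, measurable_fun setT (g n)) ->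
  measurable_fun setT (fun w => limn_einf (g ^~ w)).
Proof.
move=> mg; rewrite (_ : (fun w => _) = fun w => (- limn_esup (-%E \o g ^~ w))%E); last first.
  by apply/funext => w; rewrite -limn_einfN; congr limn_einf; apply/funext => n /=; rewrite oppeK.
apply: measurableT_comp => //.
apply: (@measurable_fun_limn_esup _ _ _ _ (fun n w => (- g n w)%E)) => n.
exact: measurableT_comp.
Qed.

Lemma limn_einf_prob_geometric (u : (\bar R)^nat) (c : R) : 0 < c -> c <= 1 ->
  (forall h, (0 < h)%N -> ((1 - (1 - c) ^+ h)%:E <= u h <= 1)%E) ->
  limn_einf u = 1%E.
Proof.
move=> c0 c1 hu.
have ul : u @ \oo --> 1%E.
  apply: (@squeeze_cvge _ _ _ _ (fun h => (1 - (1 - c) ^+ h)%:E) _ (fun=> 1%E)).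
  (* The bounds start at [h = 1]; the term at [h = 0] is unconstrained. *)
  - by exists 1%N => // h /= h0; exact: hu.
  - apply: cvg_EFin; first exact: nearW.
    have : 1 - (1 - c) ^+ h @[h --> \oo] --> (1 - 0 : R).
      apply: cvgB; first exact: cvg_cst.
      by apply: cvg_expr; rewrite ger0_norm ?subr_ge0//; lra.
    by rewrite subr0.
  - exact: cvg_cst.
by rewrite is_cvg_limn_einfE; [exact: cvg_lim|apply/cvg_ex; exists 1%E].
Qed.

End limits.

Section measurable_loss.
Context {R : realType} {d h : nat} {disp} {Omega : measurableType disp}.
Context (P : probability Omega R) (X : Omega -> 'rV[R]_d) (Y : Omega -> R).
Hypothesis mX : measurable_fun setT X.
Hypothesis mY : measurable_fun setT Y.
Context (L : 'rV[R]_(nparams d h) -> R).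
Hypothesis LE : forall theta, (L theta)%:E =
  'E_P[(fun w => `|network theta (X w) - Y w| ^+ 2)%R]%E.

(** The loss is a partial integral of a jointly measurable nonnegative function, so Tonelli applies.
    This serves the measurability of the event in the theorem. *)
Lemma measurable_loss : measurable_fun setT (fun theta => (L theta)%:E).
Proof.
pose g (z : 'rV[R]_(nparams d h) * Omega) : R := `|network z.1 (X z.2) - Y z.2| ^+ 2.
have mp k : measurable_fun setT (fun z : 'rV[R]_(nparams d h) * Omega => param z.1 k).
  exact: (measurableT_comp (measurable_coord_rV (inord k)) measurable_fst).
have mx j : measurable_fun setT (fun z : 'rV[R]_(nparams d h) * Omega => X z.2 ord0 j).
  apply: (measurableT_comp (measurable_coord_rV j)).
  exact: (measurableT_comp mX measurable_snd).
have mn : measurable_fun setT (fun z : 'rV[R]_(nparams d h) * Omega => network z.1 (X z.2)).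
  rewrite /network; apply: measurable_funD; first exact: mp.
  apply: measurable_sum => i; apply: measurable_funM; first exact: mp.
  apply: measurable_maxr => //; apply: measurable_funD; first exact: mp.
  by apply: measurable_sum => j; exact: measurable_funM.
have mg : measurable_fun setT g.
  apply: measurable_funX; apply: measurableT_comp => //.
  apply: measurable_funB => //.
  exact: (measurableT_comp mY measurable_snd).
have := @measurable_fun_fubini_tonelli_F _ _ _ _ R P (EFin \o g) _ _.
rewrite (_ : fubini_F P (EFin \o g) = (fun theta => (L theta)%:E)).
  apply; first exact/measurable_EFinP.
  by move=> z; rewrite lee_fin /g sqr_ge0.
by apply/funext => theta; rewrite LE unlock.
Qed.

End measurable_loss.

Theorem theorem1p1
  (R : realType) (d : nat) (d_gt0 : (0 < d)%N)
  (a b : R) (ab : a < b)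
  (disp : measure_display) (Omega : measurableType disp)
  (P : probability Omega R)
  (X : nat -> nat -> {RV P >-> 'rV[R]_d})
  (X_ab : forall m n w j, a <= X m n w ord0 j <= b)
  (Y : nat -> nat -> {RV P >-> R})
  (L : forall h : nat, 'rV[R]_(nparams d h) -> R)
  (LE : forall h, (0 < h)%N -> forall theta : 'rV[R]_(nparams d h),
    (L h theta)%:E =
      'E_P[(fun w => `|network theta (X 0%N 0%N w) - Y 0%N 0%N w| ^+ 2)%R]%E)
  (f p : 'rV[R]_d -> R)
  (f_cont : continuous f) (p_cont : continuous p)
  (f_cond : exists2 Z : Omega -> R,
    is_cond_expectation P (X 0%N 0%N) (Y 0%N 0%N) Z &
    {ae P, forall w, Z w = f (X 0%N 0%N w)})
  (p_supp : p @^-1` [set y | y != 0] =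
    [set x : 'rV[R]_d | forall j, a < x ord0 j < b])
  (X_density : forall A : set 'rV[R]_d, measurable A ->
    (P (X 0%N 0%N @^-1` A) = \int[lebesgue_rV d]_(x in A) (p x)%:E)%E)
  (M : nat -> nat -> nat)
  (M_gt0 : forall h n, (0 < h)%N -> (0 < M h n)%N)
  (gamma : nat -> nat -> R)
  (fL : forall h : nat, nat -> 'rV[R]_(nparams d h) -> Omega -> R)
  (fLE : forall h n, (0 < h)%N -> forall (theta : 'rV[R]_(nparams d h)) w,
    fL h n theta w = (M h n)%:R^-1 *
      \sum_(1 <= m < (M h n).+1) `|network theta (X m n w) - Y m n w| ^+ 2)
  (G : forall h : nat, nat -> 'rV[R]_(nparams d h) -> Omega ->
    'rV[R]_(nparams d h))
  (GE : forall h n, (0 < h)%N ->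
    forall (i : 'I_h) (j : 'I_(nparams d h)), neuron_index (d := d) i j ->
    forall (theta : 'rV[R]_(nparams d h)) (w : Omega),
    differentiable (fun psi : 'rV[R]_d.+1 => fL h n (set_neuron theta i psi) w)
      (neuron_params theta i) ->
    G h n theta w ord0 j =
      'D_(delta_mx ord0 j) (fun theta' => fL h n theta' w) theta)
  (Theta : forall h : nat, nat -> {RV P >-> 'rV[R]_(nparams d h)})
  (ThetaS : forall h n, (0 < h)%N -> forall w,
    Theta h n.+1 w = Theta h n w - gamma h n *: G h n (Theta h n w) w)
  (Theta_indep : forall h, (0 < h)%N ->
    mutually_independent P
      (fun (i : 'I_(h * d + h)) w => param (Theta h 0%N w) i))
  (q : R -> R) (q_meas : measurable_fun setT q) (q_ge0 : forall y, 0 <= q y)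
  (eta : R) (eta_gt0 : 0 < eta)
  (q_gt0 : forall y, - eta < y < eta -> 0 < q y)
  (kappa : R)
  (Theta_law : forall h, (0 < h)%N -> forall (i : 'I_(h * d + h)) (x : R),
    (P [set w | (h%:R `^ kappa * param (Theta h 0%N w) i < x)%R] =
      \int[lebesgue_measure]_(y in `]-oo, x[) (q y)%:E)%E)
  (f_notin : forall h, (0 < h)%N ->
    ~ range (fun theta => (L h theta)%:E)
        'E_P[(fun w => `|f (X 0%N 0%N w) - Y 0%N 0%N w| ^+ 2)%R]%E) :
  (limn_einf (fun h : nat =>
    P [set w | ereal_inf (range (fun theta => (L h theta)%:E)) <
               limn_einf (fun n => (L h (Theta h n w))%:E)]) = 1)%E.
Proof.
pose beta := `|a| + `|b|.
have beta0 : 0 <= beta by rewrite addr_ge0.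
have mX m n : measurable_fun setT (X m n) by [].
have mY m n : measurable_fun setT (Y m n) by [].
have Xbeta m n w j : `|X m n w ord0 j| <= beta.
  by apply: closed_cube_bound => k; exact: X_ab.
have Xsupp x e : open_cube a b x -> 0 < e -> (0 < P (X 0%N 0%N @^-1` ball x e))%E.
  move=> Ox e0; apply: (density_support (mX _ _) p_cont X_density) => //.
  have : (p @^-1` [set y | y != 0]) x by rewrite p_supp.
  by [].
have not_network h (h0 : (0 < h)%N) (theta : 'rV[R]_(nparams d h)) :
    ~ {in closed_cube a b, f =1 network theta}.
  move=> fN; apply: (f_notin h h0); exists theta => //.
  rewrite LE//; congr ('E_P[_])%E; apply/funext => w.
  by rewrite fN// inE; exact: X_ab.
have mTheta h := measurable_funPT (Theta h 0%N).
(* As [dead_mass] is the same for every width, its bounds are read off from the initial law at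
   [h = 1]. *)
have c0 : 0 < dead_mass q eta d beta.
  exact: (dead_mass_gt0 q_meas q_ge0 eta_gt0 q_gt0 beta0 (ltn0Sn 0)
    (mTheta 1%N) (Theta_law 1%N (ltn0Sn 0))).
have c1 : dead_mass q eta d beta <= 1.
  exact: (dead_mass_le1 q_meas q_ge0 eta_gt0 beta0 (ltn0Sn 0) (mTheta 1%N)
    (Theta_indep 1%N (ltn0Sn 0)) (Theta_law 1%N (ltn0Sn 0))).
apply: (limn_einf_prob_geometric c0 c1) => h h0.
set S := [set w | _].
have dead_n n i w : dead beta (Theta h 0%N w) i -> dead beta (Theta h n w) i.
  move=> de; elim: n => [//|n IH]; rewrite ThetaS//.
  exact: (dead_sgd_step (fun m w => Xbeta m n w) (fLE h n h0) (GE h n h0)).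
have mS : measurable S.
  have mg n : measurable_fun setT (fun w => (L h (Theta h n w))%:E).
    exact: (measurableT_comp (measurable_loss (mX _ _) (mY _ _) (LE h h0))
      (measurable_funPT (Theta h n))).
  have := measurable_limn_einf mg measurableT
    (emeasurable_itv `]ereal_inf (range (fun theta => (L h theta)%:E)), +oo[%E).
  rewrite setTI; congr measurable; apply/seteqP; split => w /=.
    by rewrite in_itv/= andbT.
  by rewrite in_itv/= andbT.
have [A [mA PA Adead]] := dead_at_init q_meas q_ge0 eta_gt0 beta0 h0
  (mTheta h) (Theta_indep h h0) (Theta_law h h0).
apply/andP; split; last exact: probability_le1.
rewrite -PA; apply: le_measure; rewrite ?inE//.
move=> w /Adead[i de] /=.
(* The gap depends on which neuron [i] is dead, hence on [w]; no uniformity is asked for, since the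
   comparison of lower limit and infimum is made for each [w] separately. *)
have [v [theta' [Lv vL]]] := loss_gap i ab (mX _ _) (mY _ _) (X_ab 0%N 0%N) Xsupp (LE h h0)
  f_cont f_cond (not_network h h0).
apply: (@le_lt_trans _ _ (L h theta')%:E).
  by apply: ereal_inf_lbound; exists theta'.
apply: (@lt_le_trans _ _ v%:E); first by rewrite lte_fin.
by apply: limn_einf_ge => n; rewrite lee_fin; apply: vL; exact: dead_n.
Qed.
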